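(* Let $\mathbf{r}=(r_1,\dots,r_n)$ be a sequence of integers with $1\le r_1\le\cdots\le r_n\le n$ and $r_k\ge k$ for all $k$. Let $\sigma_0\in B_{\mathbf r}$ with $\sigma_0(k)>0$ for all $k>0$. Then \[ \sum_{\sigma\in B_{\mathbf r}} q^{\mathrm{inv}_B(\sigma)}t^{\mathrm{nmin}_B(\sigma)}=\sum_{\sigma\in B_{\mathbf r}} q^{\mathrm{sor}_{\mathbf r}(\sigma,\sigma_0)}t^{\ell'_B(\sigma\sigma_0^{-1})}. \]
   Context: Here $q,t$ are indeterminates. Permutations are composed as functions, $(\sigma\tau)(i)=\sigma(\tau(i))$. **Signed permutations.** $B_n$ is the group of bijections $\sigma$ of $\{\pm1,\dots,\pm n\}$ with $\sigma(-i)=-\sigma(i)$; $\bar a$ means $-a$. $B_{\mathbf r}=\{\sigma\in B_n:|\sigma(k)|\le r_k,\ 1\le k\le n\}$. With $N(\sigma)=|\{1\le i\le n:\sigma(i)<0\}|$, \[\mathrm{inv}_B(\sigma)=|\{1\le i<j\le n:\sigma(i)>\sigma(j)\}|+|\{1\le i<j\le n:-\sigma(i)>\sigma(j)\}|+N(\sigma),\] \[\mathrm{nmin}_B(\sigma)=|\{1\le i\le n:\sigma(i)>|\sigma(j)|\text{ for some }j\text{ with } i<j\le n\}|+N(\sigma).\] The transposition $(i\,j)$ in $B_n$ swaps $i$ with $j$ and, if $i\ne\bar j$, also $\bar i$ with $\bar j$. $\ell'_B(\sigma)$ (reflection length) is the minimal number of transpositions in $\{(i\,j):1\le i<j\le n\}\cup\{(\bar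 i\,j):1\le i\le j\le n\}$ whose product is $\sigma$. **Dyck paths and bicolored matchings.** A Dyck path of semilength $n$ is a lattice path from $(0,0)$ to $(2n,0)$ with steps $(1,1)$ (rises) and $(1,-1)$ (falls) never going below the $x$-axis. $D(\mathbf r)$ is the unique Dyck path of semilength $n$ whose $k$-th fall is preceded by exactly $r_k$ rises, for every $k$. A (perfect) matching on $\{1,\dots,2n\}$ is a partition into $n$ two-element blocks (edges); an edge $i\cdot j$ with $i<j$ has opener $i$ and closer $j$; $M(v)$ is the vertex in the same block as $v$. $M$ has type $D$ if, for each $v$, $v$ is an opener iff the $v$-th step of $D$ is a rise. $\mathcal M_n^{(2)}(D)$ is the set of matchings of type $D$ with each edge colored red or blue. Openers are $o_1<\cdots<o_n$, closers $c_1<\cdots<c_n$. $\mathrm{col}(v,M)=0$ if the edge at $v$ is red, $1$ if blue. **Sorting index of bicolored matchings.** Let $M\in\mathcal M_n^{(2)}(D)$ and let $M_0\in\mathcal M_n^{(2)}(D)$ have only red edges. Define $M_n=M,M_{n-1},\dots,M_1$: if $M_k(o_k)=M_0(o_k)$, then $M_{k-1}$ has the same edges and colors as $M_k$ except that the edge at $o_k$ is red. Otherwise replace the edges $o_k\cdot M_k(o_k)$ and $M_k(M_0(o_k))\cdot M_0(o_k)$ of $M_k$ by $o_k\cdot M_0(o_k)$ and $M_k(M_0(o_k))\cdot M_k(o_k)$, with $\mathrm{col}(o_i,M_{k-1})=\mathrm{col}(o_i,M_k)+\mathrm{col}(o_k,M_k)\pmod 2$ if $o_i\in\{o_k,M_k(M_0(o_k))\}$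 and $\mathrm{col}(o_i,M_{k-1})=\mathrm{col}(o_i,M_k)$ otherwise. Let $a_k=|\{c:c>o_k,\ c\in[M_k(o_k),M_0(o_k)],\ M_0(c)<o_k\}|$ if $M_k(o_k)\le M_0(o_k)$ and $a_k=|\{c:c>o_k,\ c\notin(M_0(o_k),M_k(o_k)),\ M_0(c)<o_k\}|$ if $M_0(o_k)<M_k(o_k)$. Put $\mathrm{sor}_k(M,M_0)=a_k$ if $\mathrm{col}(o_k,M_k)=0$ and $\mathrm{sor}_k(M,M_0)=2k-1-a_k$ if $\mathrm{col}(o_k,M_k)=1$; $\mathrm{sor}(M,M_0)=\sum_{k=1}^n\mathrm{sor}_k(M,M_0)$. **The statistic $\mathrm{sor}_{\mathbf r}$.** The bijection $g_{\mathbf r}:B_{\mathbf r}\to\mathcal M_n^{(2)}(D(\mathbf r))$ sends $\sigma$ to the matching with edges $o_{|\sigma(k)|}\cdot c_k$, $1\le k\le n$, colored red if $\sigma(k)>0$ and blue if $\sigma(k)<0$. For $\sigma,\sigma_0\in B_{\mathbf r}$ with $\sigma_0(k)>0$ for all $k>0$, $\mathrm{sor}_{\mathbf r}(\sigma,\sigma_0)=\mathrm{sor}(g_{\mathbf r}(\sigma),g_{\mathbf r}(\sigma_0))$. *)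

(* Defs.v *)
From HB Require Import structures.
From mathcomp Require Import all_boot all_order all_algebra all_fingroup.

Set Implicit Arguments.
Unset Strict Implicit.
Unset Printing Implicit Defensive.

Import Order.TTheory GRing.Theory Num.Theory.

(* Indices 1..n and vertices 1..2n are represented by the 0-based ordinals
   'I_n and 'I_(n + n); the letters +-1, ..., +-n by 'I_n * bool, where
   (i, false) is i + 1 and (i, true) is -(i + 1). *)

Section SignedPermutations.

Variable n : nat.

Definition letter : finType := ('I_n * bool)%type.

Definition posl (i : 'I_n) : letter := (i, false).
Definition negl (i : 'I_n) : letter := (i, true).
Definition oppl (x : letter) : letter := (x.1, ~~ x.2).

Definition letter_abs (x : letter) : nat := x.1.+1.
Definition letter_int (x : letter) : int :=
  (if x.2 then - (letter_abs x)%:Z else (letter_abs x)%:Z)%R.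

Definition signed_perms : {set {perm letter}} :=
  [set s : {perm letter} | [forall x, s (oppl x) == oppl (s x)]].

(* The integer s(i), for a positive index i. *)
Definition sint (s : {perm letter}) (i : 'I_n) : int := letter_int (s (posl i)).

Definition signed_perms_below (r : 'I_n -> nat) : {set {perm letter}} :=
  [set s in signed_perms | [forall k, letter_abs (s (posl k)) <= r k]].

Definition Nneg (s : {perm letter}) : nat := #|[set i | (sint s i < 0)%R]|.

Definition invB (s : {perm letter}) : nat :=
  #|[set p : 'I_n * 'I_n | (p.1 < p.2) && (sint s p.1 > sint s p.2)%R]|
  + #|[set p : 'I_n * 'I_n | (p.1 < p.2) && (- sint s p.1 > sint s p.2)%R]|
  + Nneg s.

Definition nminB (s : {perm letter}) : nat :=
  #|[set i : 'I_n | [exists j : 'I_n, (i < j) && (sint s i > `|sint s j|)%R]]|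
  + Nneg s.

Definition transp (x y : letter) : {perm letter} :=
  if x == oppl y then tperm x y else (tperm x y * tperm (oppl x) (oppl y))%g.

Definition transps : {set {perm letter}} :=
  [set transp (posl p.1) (posl p.2) | p : 'I_n * 'I_n & p.1 < p.2]
  :|: [set transp (negl p.1) (posl p.2) | p : 'I_n * 'I_n & p.1 <= p.2].

Lemma opplK : involutive oppl.
Proof. by case=> i b; rewrite /oppl /= negbK. Qed.

Lemma oppl_neq x : (oppl x == x) = false.
Proof. by case: x => i b; apply/eqP => -[]; case: b. Qed.

Lemma eq_opplC x y : (x == oppl y) = (y == oppl x).
Proof. by rewrite -(can2_eq opplK opplK) eq_sym. Qed.

Lemma transpC x y : transp x y = transp y x.
Proof.
rewrite /transp eq_opplC tpermC.
by case: eqP => // _; rewrite [tperm (oppl x) _]tpermC.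
Qed.

Lemma tperm_oppl_comm x y :
  x != oppl y -> commute (tperm x y) (tperm (oppl x) (oppl y)).
Proof.
move=> xNy; apply/commgP/conjg_fixP.
by rewrite tpermJ !tpermD ?oppl_neq // eq_sym // eq_opplC.
Qed.

Lemma transpN x y : transp (oppl x) (oppl y) = transp x y.
Proof.
rewrite /transp (inj_eq (can_inj opplK)) !opplK.
case: eqP => [->|/eqP xNy]; first by rewrite !opplK tpermC.
by rewrite tperm_oppl_comm.
Qed.

Lemma mem_transps x y : x != y -> transp x y \in transps.
Proof.
move=> xy; rewrite inE.
have same i j b : (i, b) != (j, b) -> exists2 p : 'I_n * 'I_n, p.1 < p.2 &
    transp (i, b) (j, b) = transp (posl p.1) (posl p.2).
  move=> ij; have {}ij : i != j by apply: contra ij => /eqP ->.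
  have tE k l : transp (k, b) (l, b) = transp (posl k) (posl l).
    by case: b {ij} => //; rewrite -transpN.
  case: (ltngtP i j) => [h|h|h]; first by exists (i, j).
    by exists (j, i) => //; rewrite tE transpC.
  by rewrite (val_inj h) eqxx in ij.
have diff i j : exists2 p : 'I_n * 'I_n, p.1 <= p.2 &
    transp (i, true) (j, false) = transp (negl p.1) (posl p.2).
  case: (leqP i j) => h; first by exists (i, j).
  by exists (j, i) => /=; rewrite ?(ltnW h) // transpC -transpN.
case: x y xy => [i [|]] [j [|]] xy; apply/orP.
- by left; have [p ? ->] := same _ _ _ xy; apply/imsetP; exists p; rewrite ?inE.
- by right; have [p ? ->] := diff i j; apply/imsetP; exists p; rewrite ?inE.
- right; rewrite transpC; have [p ? ->] := diff j i.
  by apply/imsetP; exists p; rewrite ?inE.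
- by left; have [p ? ->] := same _ _ _ xy; apply/imsetP; exists p; rewrite ?inE.
Qed.

Lemma transpL x y : transp x y x = y.
Proof.
rewrite /transp; case: eqP => [->|/eqP xNy]; first by rewrite tpermL.
by rewrite permM tpermL tpermD ?oppl_neq // eq_sym eq_opplC.
Qed.

Lemma transpR x y : transp x y y = x.
Proof. by rewrite transpC transpL. Qed.

Lemma transpK x y : (transp x y * transp x y = 1)%g.
Proof.
rewrite /transp; case: eqP => [->|/eqP xNy]; first by rewrite tperm2.
have c := tperm_oppl_comm xNy.
by rewrite -mulgA (mulgA (tperm _ _) (tperm x y)) -c -!mulgA tperm2 mulg1 tperm2.
Qed.

Lemma transpD x y z :
  z != x -> z != y -> z != oppl x -> z != oppl y -> transp x y z = z.
Proof.
move=> h1 h2 h3 h4; rewrite /transp; case: ifP => _.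
  by rewrite tpermD // eq_sym.
by rewrite permM !tpermD // eq_sym.
Qed.

Lemma transp_signed x y : transp x y \in signed_perms.
Proof.
rewrite inE; apply/forallP => z; apply/eqP.
have tN : transp x y (oppl x) = oppl y.
  by rewrite -[transp x y]transpN transpL.
have tN' : transp x y (oppl y) = oppl x.
  by rewrite -[transp x y]transpN transpR.
have [->|h1] := eqVneq z x; first by rewrite transpL tN.
have [->|h2] := eqVneq z y; first by rewrite transpR tN'.
have [->|h3] := eqVneq z (oppl x); first by rewrite tN // !opplK transpL.
have [->|h4] := eqVneq z (oppl y); first by rewrite tN' // !opplK transpR.
by rewrite !transpD // ?(inj_eq (can_inj opplK)) // (can2_eq opplK opplK).
Qed.

Lemma signed_perms_group_set : group_set signed_perms.
Proof.
apply/group_setP; split; first by rewrite inE; apply/forallP=> x; rewrite !perm1.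
move=> s t; rewrite !inE => /forallP hs /forallP ht; apply/forallP => x.
by rewrite !permM (eqP (hs x)) (eqP (ht _)).
Qed.
Canonical signed_perms_group := Group signed_perms_group_set.

(* [transps ^+ k] is the set of all products of k elements of [transps]. *)
Lemma transp_word (s : {perm letter}) :
  exists k, (s \in signed_perms) ==> (s \in transps ^+ k)%g.
Proof.
have [m] := ubnP #|[set x | s x != x]|; elim: m s => // m IH s; rewrite ltnS => hm.
have [sB|_] := boolP (s \in signed_perms); last by exists 0.
have [/existsP[x sx]|] := boolP [exists x, s x != x]; last first.
  rewrite negb_exists => /forallP h; exists 0.
  rewrite expg0 inE; apply/eqP/permP => x.
  by rewrite perm1; apply/eqP; rewrite -[_ == _]negbK.
have sN u : s (oppl u) = oppl (s u).
  by move: sB; rewrite inE => /forallP/(_ u)/eqP.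
set t := transp x (s x); have tB : t \in signed_perms by apply: transp_signed.
have [|k] := IH (s * t)%g.
  apply: leq_trans hm; apply: proper_card; apply/properP; split.
    apply/subsetP => z; rewrite !inE permM; apply: contra => /eqP sz.
    have zx : z != x by apply: contra sx => /eqP <-; rewrite sz.
    have zy : z != s x by rewrite -{1}sz (inj_eq perm_inj).
    rewrite sz transpD //.
      apply: contra zx => /eqP zE; move: sz; rewrite zE sN.
      by move/(can_inj opplK) => h; rewrite h eqxx in sx.
    apply: contra zy => /eqP zE; move: sz; rewrite zE sN.
    by move/(can_inj opplK)/perm_inj => h; rewrite h eqxx in sx.
  by exists x; rewrite !inE // permM transpR eqxx.
rewrite groupM // /= => hk; exists k.+1.
rewrite expgSr -[s]mulg1 -(transpK x (s x)) mulgA.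
by apply: mem_mulg => //; rewrite mem_transps // eq_sym.
Qed.

(* For s in B_n, the least k such that s is a product of k transpositions. *)
Definition reflection_length (s : {perm letter}) : nat := ex_minn (transp_word s).

End SignedPermutations.

Section DyckPaths.

Variable n : nat.

(* true is a rise, false is a fall. *)
Definition steps := (n + n).-tuple bool.

Definition is_dyck (D : steps) : bool :=
  (count id D == n) &&
  [forall m : 'I_(n + n).+1, count negb (take m D) <= count id (take m D)].

(* [lshift n k] is a default value, irrelevant for paths with n rises and n
   falls. *)
Definition opener (D : steps) (k : 'I_n) : 'I_(n + n) :=
  nth (lshift n k) [seq v <- enum 'I_(n + n) | tnth D v] k.
Definition closer (D : steps) (k : 'I_n) : 'I_(n + n) :=
  nth (lshift n k) [seq v <- enum 'I_(n + n) | ~~ tnth D v] k.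

Definition falls_preceded_by (r : 'I_n -> nat) (D : steps) : bool :=
  [forall k, count id (take (closer D k) D) == r k].

(* The path D(r): its fall number k (from 0) is preceded by r k rises and k
   falls, hence is step number r k + k (from 0); see [dyck_ofP]. *)
Definition dyck_of (r : 'I_n -> nat) : steps :=
  [tuple ~~ [exists k : 'I_n, v == r k + k :> nat] | v < n + n].

Lemma count_take_index (T : eqType) (P : pred T) (x0 : T) (e : seq T) (k : nat) :
  uniq e -> k < count P e ->
  count P (take (index (nth x0 (filter P e) k) e) e) = k.
Proof.
elim: e k => //= x e IH k /andP[xe ue].
have step j : j < count P e -> (x == nth x0 (filter P e) j) = false.
  move=> hj; apply: contraNF xe => /eqP ->.
  by apply: (mem_subseq (filter_subseq P e)); rewrite mem_nth ?size_filter.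
case Px: (P x) => /=; last by move=> hk; rewrite step //= Px IH.
by case: k => [|k] /= hk; rewrite ?eqxx // step //= Px IH.
Qed.

Lemma count_take_mono (T : Type) (a : pred T) (m1 m2 : nat) (e : seq T) :
  m1 <= m2 -> count a (take m1 e) <= count a (take m2 e).
Proof.
move=> h; rewrite -(take_takel e h) -{2}(cat_take_drop m1 (take m2 e)).
by rewrite count_cat leq_addr.
Qed.

Lemma size_filter_steps (a : pred bool) (D : steps) :
  size [seq v <- enum 'I_(n + n) | a (tnth D v)] = count a D.
Proof. by rewrite size_filter -[in RHS](map_tnth_enum D) count_map. Qed.

Lemma count_take_steps (a : pred bool) (D : steps) (x0 : 'I_(n + n)) (k : nat) :
  k < count a D ->
  count a (take (nth x0 [seq v <- enum 'I_(n + n) | a (tnth D v)] k) D) = k.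
Proof.
move=> hk; set v := nth _ _ _.
rewrite -[in take _ D](map_tnth_enum D) -map_take count_map.
rewrite -[X in take X _](index_enum_ord v).
apply: count_take_index; first exact: enum_uniq.
by rewrite -size_filter size_filter_steps.
Qed.

Lemma count_falls (D : steps) : count id D = n -> count negb D = n.
Proof.
move=> h; have := count_predC id D; rewrite size_tuple h => /eqP.
by rewrite eqn_add2l => /eqP.
Qed.

Lemma openerP (D : steps) (k : 'I_n) : count id D = n ->
  tnth D (opener D k) /\ count id (take (opener D k) D) = k.
Proof.
move=> h; split; last by apply: (count_take_steps (a := id)); rewrite h.
have : opener D k \in [seq v <- enum 'I_(n + n) | tnth D v].
  by rewrite mem_nth // (size_filter_steps id) h.
by rewrite mem_filter => /andP[].
Qed.

Lemma closerP (D : steps) (k : 'I_n) : count id D = n ->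
  ~~ tnth D (closer D k) /\ count negb (take (closer D k) D) = k.
Proof.
move=> /count_falls h; split; last by apply: count_take_steps; rewrite h.
have : closer D k \in [seq v <- enum 'I_(n + n) | ~~ tnth D v].
  by rewrite mem_nth // (size_filter_steps negb) h.
by rewrite mem_filter => /andP[].
Qed.

Lemma riseE (D : steps) (v : 'I_(n + n)) : count id D = n ->
  tnth D v -> exists k, v = opener D k.
Proof.
move=> h Dv; set s := [seq v <- enum 'I_(n + n) | tnth D v].
have vs : v \in s by rewrite mem_filter Dv mem_enum.
have hi : index v s < n.
  by move: vs; rewrite -index_mem (size_filter_steps id) h.
by exists (Ordinal hi); rewrite /opener /= nth_index.
Qed.

Lemma fallE (D : steps) (v : 'I_(n + n)) : count id D = n ->
  ~~ tnth D v -> exists k, v = closer D k.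
Proof.
move=> /count_falls h Dv; set s := [seq v <- enum 'I_(n + n) | ~~ tnth D v].
have vs : v \in s by rewrite mem_filter Dv mem_enum.
have hi : index v s < n.
  by move: vs; rewrite -index_mem (size_filter_steps negb) h.
by exists (Ordinal hi); rewrite /closer /= nth_index.
Qed.

Lemma count_take_add (D : steps) (m : nat) : m <= n + n ->
  count id (take m D) + count negb (take m D) = m.
Proof.
by move=> hm; rewrite count_predC size_take size_tuple; case: ltngtP hm.
Qed.

Section Admissible.

Variable r : 'I_n -> nat.
Hypothesis r_mono : forall i j : 'I_n, i <= j -> r i <= r j.
Hypothesis r_len : forall k : 'I_n, r k <= n.
Hypothesis r_gek : forall k : 'I_n, k < r k.

Lemma dyck_of_falls :
  [seq val v | v <- enum 'I_(n + n) & ~~ tnth (dyck_of r) v]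
  = [seq r k + k | k <- enum 'I_n].
Proof.
have ltE m : sorted (relpre val ltn) (enum 'I_m).
  by rewrite -sorted_map val_enum_ord iota_ltn_sorted.
apply: (irr_sorted_eq ltn_trans ltnn).
- rewrite sorted_map; apply: sorted_filter (ltE _).
  by move=> x y z; apply: ltn_trans.
- rewrite sorted_map; apply: sub_sorted (ltE _) => i j /= ij.
  by rewrite -addnS leq_add // r_mono // ltnW.
move=> x; apply/mapP/mapP => -[v]; rewrite ?mem_filter.
  rewrite tnth_mktuple negbK => /andP[/existsP[k /eqP vk] _] ->.
  by exists k; rewrite ?mem_enum.
move=> _ ->; have h : r v + v < n + n by rewrite -addnS leq_add.
exists (Ordinal h) => //; rewrite mem_filter mem_enum tnth_mktuple negbK andbT.
by apply/existsP; exists v.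
Qed.

Lemma dyck_of_count : count id (dyck_of r) = n.
Proof.
have h : count negb (dyck_of r) = n.
  by rewrite -size_filter_steps -(size_map val) dyck_of_falls size_map size_enum_ord.
have := count_predC id (dyck_of r); rewrite size_tuple h => /eqP.
by rewrite eqn_add2r => /eqP.
Qed.

Lemma closer_dyck_of k : closer (dyck_of r) k = r k + k :> nat.
Proof.
have szE : size [seq v <- enum 'I_(n + n) | ~~ tnth (dyck_of r) v] = n.
  by rewrite -(size_map val) dyck_of_falls size_map size_enum_ord.
rewrite /closer -(nth_map _ 0 val) ?szE // dyck_of_falls.
by rewrite (nth_map k) ?size_enum_ord // nth_ord_enum.
Qed.

Lemma dyck_ofP (D : steps) :
  is_dyck D && falls_preceded_by r D = (D == dyck_of r).
Proof.
apply/andP/eqP => [[/andP[/eqP hD _] /forallP hr]|->].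
  have cE k : closer D k = r k + k :> nat.
    have [_ h] := closerP k hD.
    by rewrite -[LHS](count_take_add D (ltnW (ltn_ord _))) h (eqP (hr k)).
  apply: eq_from_tnth => v; rewrite tnth_mktuple; apply/idP/idP => h.
    apply/negP => /existsP[k /eqP vk].
    have vc : v = closer D k by apply: val_inj; rewrite /= cE.
    by have [] := closerP k hD; rewrite -vc h.
  apply: contraNT h => /(fallE hD)[k ->].
  by apply/existsP; exists k; rewrite cE.
have hD := dyck_of_count; move: (dyck_of r) closer_dyck_of hD => {}D cE hD.
have hr k : count id (take (closer D k) D) = r k.
  have [_ h] := closerP k hD; apply/eqP; rewrite -(eqn_add2r k) -{1}h.
  by rewrite count_take_add ?cE // -cE ltnW.
split; last by apply/forallP => k; apply/eqP.
apply/andP; split; first by apply/eqP.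
apply/forallP => m; set F := count negb _.
case EF: F => [|j] //.
have hj : j < n.
  rewrite -EF -(count_falls hD) /F -[X in _ <= count _ X](cat_take_drop m).
  by rewrite count_cat leq_addr.
pose k := Ordinal hj; have [_ ck] := closerP k hD.
have km : closer D k <= m.
  rewrite leqNgt; apply/negP => /ltnW/(count_take_mono negb D).
  by rewrite ck -/F EF ltnn.
by apply: leq_trans (count_take_mono _ _ km); rewrite hr; apply: (r_gek k).
Qed.

End Admissible.

End DyckPaths.

Section Matchings.

Variable n : nat.

Local Notation vertex := 'I_(n + n).

Record bimatching := BiMatching {
  edges : {set {set vertex}};
  blue : {set {set vertex}}
}.

Definition mate (M : bimatching) (v : vertex) : vertex :=
  odflt v [pick w in pblock (edges M) v | w != v].

Definition col (M : bimatching) (v : vertex) : bool :=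
  pblock (edges M) v \in blue M.

Definition is_bimatching (D : steps n) (M : bimatching) : bool :=
  [&& partition (edges M) [set: vertex],
      [forall e in edges M, #|e| == 2],
      [forall v : vertex, (v < mate M v) == tnth D v]
    & blue M \subset edges M].

(* The step from M = M_{k+1} to M_k: [k] is 0-based, so the opener treated is
   o_{k+1}. *)
Definition sort_step (D : steps n) (M0 : bimatching) (k : 'I_n)
    (M : bimatching) : bimatching :=
  let o := opener D k in
  let c := mate M0 o in
  if mate M o == c then BiMatching (edges M) (blue M :\ pblock (edges M) o)
  else
    let o' := mate M c in
    let c' := mate M o in
    let E := [set [set o; c]; [set o'; c']]
             :|: (edges M :\: [set [set o; c']; [set o'; c]]) in
    let newcol i := if opener D i \in [set o; o']
                    then col M (opener D i) (+) col M o
                    else col M (opener D i) in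
    BiMatching E [set e in E | [exists i, (opener D i \in e) && newcol i]].

(* M_{k+1}: the steps of 0-based indices n - 1, n - 2, ..., k + 1 applied to M,
   in this order. *)
Definition sort_state (D : steps n) (M M0 : bimatching) (k : 'I_n) : bimatching :=
  foldr (sort_step D M0) M [seq j : 'I_n <- enum 'I_n | k < j].

Definition sor_count (D : steps n) (M M0 : bimatching) (k : 'I_n) : nat :=
  let o := opener D k in
  let x := mate (sort_state D M M0 k) o in
  let y := mate M0 o in
  if x <= y then
    #|[set c : vertex | [&& o < c, x <= c <= y & mate M0 c < o]]|
  else
    #|[set c : vertex | [&& o < c, ~~ (y < c < x) & mate M0 c < o]]|.

(* sor_{k+1}. At most k vertices are counted by a, so the subtraction
   below is not truncated. *)
Definition sor_at (D : steps n) (M M0 : bimatching) (k : 'I_n) : nat :=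
  let a := sor_count D M M0 k in
  if col (sort_state D M M0 k) (opener D k) then 2 * k.+1 - 1 - a else a.

Definition sor (D : steps n) (M M0 : bimatching) : nat :=
  \sum_(k < n) sor_at D M M0 k.

Definition matching_edge (D : steps n) (s : {perm letter n}) (k : 'I_n) :
    {set vertex} :=
  [set opener D (s (posl k)).1; closer D k].

Definition matching_of (r : 'I_n -> nat) (s : {perm letter n}) : bimatching :=
  BiMatching [set matching_edge (dyck_of r) s k | k : 'I_n]
             [set matching_edge (dyck_of r) s k | k : 'I_n & (sint s k < 0)%R].

Lemma mateE (M : bimatching) (a b : vertex) :
  a != b -> pblock (edges M) a = [set a; b] -> mate M a = b.
Proof.
move=> ab h; rewrite /mate h; case: pickP => /= [w|/(_ b)].
  by rewrite !inE => /andP[/orP[]/eqP -> //]; rewrite eqxx.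
by rewrite !inE eqxx orbT eq_sym ab.
Qed.

Lemma opener_inj (D : steps n) : count id D = n -> injective (opener D).
Proof.
move=> hD i j ij; apply: val_inj => /=.
by have [_ <-] := openerP i hD; have [_ <-] := openerP j hD; rewrite ij.
Qed.

Lemma closer_inj (D : steps n) : count id D = n -> injective (closer D).
Proof.
move=> hD i j ij; apply: val_inj => /=.
by have [_ <-] := closerP i hD; have [_ <-] := closerP j hD; rewrite ij.
Qed.

Lemma opener_neq_closer (D : steps n) i j :
  count id D = n -> (opener D i == closer D j) = false.
Proof.
move=> hD; apply/eqP => h; have [hi _] := openerP i hD.
by have [/negP[]] := closerP j hD; rewrite -h.
Qed.

Lemma matching_ofP (r : 'I_n -> nat) (s : {perm letter n}) :
  (forall i j : 'I_n, i <= j -> r i <= r j) ->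
  (forall k : 'I_n, r k <= n) -> (forall k : 'I_n, k < r k) ->
  s \in signed_perms_below r -> is_bimatching (dyck_of r) (matching_of r s).
Proof.
move=> r_mono r_len r_gek; rewrite !inE => /andP[/forallP sN /forallP sr].
have hD := dyck_of_count r_mono r_len.
have /andP[_ /forallP rD] : is_dyck (dyck_of r) && falls_preceded_by r (dyck_of r).
  by rewrite dyck_ofP.
rewrite /matching_of; set D := dyck_of r in hD rD *; set M := BiMatching _ _.
pose a k := (s (posl k)).1; pose e k := matching_edge D s k.
have a_inj : injective a.
  move=> i j aij; suff [] : posl i = posl j \/ posl i = oppl (posl j) by case.
  have [|] := eqVneq (s (posl i)).2 (s (posl j)).2 => bij.
    left; apply: (@perm_inj _ s); move: aij bij; rewrite /a.
    by case: (s (posl i)) (s (posl j)) => [x b] [y c] /= -> ->.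
  right; apply: (@perm_inj _ s); rewrite (eqP (sN _)); move: aij bij; rewrite /a.
  by case: (s (posl i)) (s (posl j)) => [x b] [y c] /= ->; case: b; case: c.
have [a' aK a'K] := injF_bij a_inj.
have mem_o i k : (opener D i \in e k) = (i == a k).
  by rewrite !inE opener_neq_closer // orbF (inj_eq (opener_inj hD)).
have mem_c i k : (closer D i \in e k) = (i == k).
  by rewrite !inE eq_sym opener_neq_closer // (inj_eq (closer_inj hD)).
have vertexP v : exists k, v = opener D (a k) \/ v = closer D k.
  have [/(riseE hD)[i ->]|/(fallE hD)[k ->]] := boolP (tnth D v).
    by exists (a' i); left; rewrite a'K.
  by exists k; right.
have e_eq v k l : v \in e k -> v \in e l -> k = l.
  have [m [->|->]] := vertexP v; rewrite ?mem_o ?mem_c => /eqP hk /eqP hl.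
    by apply: a_inj; rewrite -hk.
  by rewrite -hk.
have tiE : trivIset (edges M).
  apply/trivIsetP => _ _ /imsetP[k _ ->] /imsetP[l _ ->] kl.
  apply/pred0P => v /=; apply/negP => /andP[vk vl].
  by rewrite (e_eq v k l vk vl) eqxx in kl.
have pbE v k : v \in e k -> pblock (edges M) v = e k.
  by move=> vk; apply: def_pblock vk => //; apply: imset_f.
have lt_oc k : opener D (a k) < closer D k.
  have [_ ho] := openerP (a k) hD.
  rewrite ltnNge; apply/negP => /(count_take_mono id D).
  by rewrite ho (eqP (rD k)) leqNgt => /negP; apply; apply: sr.
have oc k : opener D (a k) != closer D k by rewrite opener_neq_closer.
apply/and4P; split.
- apply/and3P; split=> //.
    rewrite eqEsubset subsetT /=; apply/subsetP => v _.
    have [k hk] := vertexP v; apply/bigcupP; exists (e k); first exact: imset_f.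
    by case: hk => ->; rewrite ?mem_o ?mem_c.
  apply/imsetP => -[k _ h]; have := mem_c k k.
  by rewrite /e -h inE eqxx.
- by apply/forall_inP => _ /imsetP[k _ ->]; rewrite cards2 oc.
- apply/forallP => v; have [k [->|->]] := vertexP v.
    have -> : mate M (opener D (a k)) = closer D k.
      by apply: mateE => //; rewrite (pbE _ k) ?mem_o.
    by rewrite lt_oc; have [->] := openerP (a k) hD.
  have -> : mate M (closer D k) = opener D (a k).
    by apply: mateE; rewrite 1?eq_sym // (pbE _ k) ?mem_c // setUC.
  by rewrite ltnNge ltnW ?lt_oc //=; have [/negPf ->] := closerP k hD.
- by apply/subsetP => _ /imsetP[k _ ->]; apply: imset_f.
Qed.

Definition sor_r (r : 'I_n -> nat) (s s0 : {perm letter n}) : nat :=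
  sor (dyck_of r) (matching_of r s) (matching_of r s0).

End Matchings.

(* The indeterminates q and t of Z[q][t]. *)
Definition qvar : {poly {poly int}} := ('X%:P)%R.
Definition tvar : {poly {poly int}} := ('X)%R.

(* Main.v *)
Require Import Defs.
From mathcomp Require Import all_boot all_order all_algebra all_fingroup.
From mathcomp Require Import zify.

(** Let h_k = k - #{p : r_p < k}.  Both sides equal the product over k of the
    sum, over 0 <= a < h_k and a sign, of q^a (positive sign) or q^(2k-1-a)
    (negative sign), times t unless a = 0 and the sign is positive.

    On the left, k contributes according to its sign and to the number a of
    smaller absolute values standing to the right of +-k; the largest value on
    which two signed permutations are placed differently shows that these data
    determine the permutation.

    On the right, sorting the opener o_k turns sigma into
    (sigma sigma_0^{-1}(k)  k) sigma, so it removes k from its cycle in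
    w = sigma sigma_0^{-1}; this lowers the reflection length by one unless
    w(k) = k already.  The signed position of k before this step ranges freely
    over 2 h_k possibilities, on which a_k and the colour take every pair of
    values exactly once.  In particular |B_r| is the product of the 2 h_k, so
    the injection used on the left is a bijection. *)

Set Implicit Arguments.
Unset Strict Implicit.
Unset Printing Implicit Defensive.

(** * Reflection length *)

Section SignedPermutations.

Variable n : nat.
Implicit Types (s t u : {perm letter n}) (x y z : letter n).

Lemma signedN s x : s \in signed_perms n -> s (oppl x) = oppl (s x).
Proof. by rewrite inE => /forallP/(_ x)/eqP. Qed.

Lemma signed_posl s i b : s \in signed_perms n ->
  s (i, b) = ((s (posl i)).1, (s (posl i)).2 (+) b).
Proof.
move=> sB; case: b; last by rewrite addbF -surjective_pairing.
by rewrite (_ : (i, true) = oppl (posl i)) // signedN // addbT.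
Qed.

Lemma letter_same x y : x.1 = y.1 -> x = y \/ x = oppl y.
Proof.
by case: x y => [i [|]] [j [|]] /= ->; [left | right | right | left].
Qed.

Lemma signed_abs s x y : s \in signed_perms n ->
  ((s x).1 == (s y).1) = (x.1 == y.1).
Proof.
move=> sB; apply/eqP/eqP => /letter_same[]; last 2 first.
- by move=> ->.
- by move=> ->; rewrite signedN.
- by move/perm_inj=> ->.
- by rewrite -signedN // => /perm_inj ->.
Qed.

Lemma transp_id x : transp x x = 1%g.
Proof. by rewrite /transp eq_sym oppl_neq !tperm1 mulg1. Qed.

Lemma transpV x y : ((transp x y)^-1 = transp x y)%g.
Proof. by apply/eqP; rewrite eq_invg_mul transpK. Qed.

Lemma transpJ s x y : s \in signed_perms n ->
  (transp x y ^ s = transp (s x) (s y))%g.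
Proof.
move=> sB; rewrite /transp -signedN // (inj_eq perm_inj).
by case: ifP => _; rewrite ?conjMg !tpermJ ?signedN.
Qed.

Lemma transp_mulC s x y : s \in signed_perms n ->
  (transp x y * s = s * transp (s x) (s y))%g.
Proof. by move=> sB; rewrite -transpJ // -conjgC. Qed.

Lemma transp_abs x y z : z.1 != x.1 -> z.1 != y.1 -> transp x y z = z.
Proof.
move=> zx zy; rewrite transpD //; [move: zx|move: zy|move: zx|move: zy];
  by apply: contraNneq => ->.
Qed.

(** A reflection moves only [x], [y] and their opposites, and it can be rewritten starting from any
    of these letters. *)
Lemma transp_moved x y z : transp x y z != z -> transp x y = transp z (transp x y z).
Proof.
have [->|zx] := eqVneq z x; first by rewrite transpL.
have [->|zy] := eqVneq z y; first by rewrite transpR transpC.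
have [->|zNx] := eqVneq z (oppl x); first by rewrite -{3}transpN transpL transpN.
have [->|zNy] := eqVneq z (oppl y).
  by rewrite -{3}transpN transpR transpC transpN.
by rewrite transpD ?eqxx.
Qed.

Lemma transpsP u : u \in transps n ->
  exists2 p : letter n * letter n, p.1 != p.2 & u = transp p.1 p.2.
Proof.
rewrite inE => /orP[] /imsetP[[i j]]; rewrite inE /= => ij ->.
  by exists (posl i, posl j) => //=; apply: contraTneq ij => -[->]; rewrite ltnn.
by exists (negl i, posl j) => /=; first by apply/eqP.
Qed.

Lemma transps_moved u x : u \in transps n -> u x != x -> u = transp x (u x).
Proof. by case/transpsP => -[y z] _ -> /transp_moved. Qed.

Lemma transps_signed u : u \in transps n -> u \in signed_perms n.
Proof. by case/transpsP => p _ ->; apply: transp_signed. Qed.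

Lemma transpsJ s u :
  s \in signed_perms n -> u \in transps n -> (u ^ s)%g \in transps n.
Proof.
move=> sB /transpsP[p p12 ->]; rewrite transpJ //.
by rewrite mem_transps // (inj_eq perm_inj).
Qed.

(* Both sides negate [x] and [y]. *)
Lemma transp_negate x y : x.1 != y.1 ->
  (transp x y * transp x (oppl y) = transp y (oppl y) * transp x (oppl x))%g.
Proof.
move=> xy; set c := transp x (oppl x).
have cy : c y = y by rewrite /c transp_abs // eq_sym.
have -> : transp x (oppl y) = (transp x y ^ c)%g.
  by rewrite transpJ ?transp_signed // transpL cy -transpN opplK.
rewrite conjgE transpV -/c !mulgA; congr (_ * _)%g.
rewrite -{1}[transp x y]transpV -mulgA -conjgE transpJ ?transp_signed //.
by rewrite transpL signedN ?transp_signed // transpL.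
Qed.

(** The product fixes [x]. It equals [t] if [t] fixes [x], a conjugate of [t] if [t] fixes [y]
    instead, and otherwise the sign change of [t x]. *)
Lemma transps_triple t x y : t \in transps n -> x != y -> t y != x ->
  (transp x y * t * transp x (t y))%g \in transps n.
Proof.
move=> tT xy tyx; have tB := transps_signed tT.
have [tx|tx] := eqVneq (t x) x.
  by rewrite transp_mulC // tx -mulgA transpK mulg1.
have tE := transps_moved tT tx; set x' := t x in tx tE.
have [ty|ty] := eqVneq (t y) y.
  rewrite ty -mulgA -{1}[transp x y]transpV -conjgE.
  by rewrite transpsJ ?transp_signed.
have yx' : y != x' by apply: contra tyx => /eqP ->; rewrite tE transpR.
(* Otherwise [t] is the sign change of [x]; as it moves [y], this forces [y = oppl x = t x],
   excluded by [yx']. *)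
have x'B : x'.1 != x.1.
  apply: contra ty => /eqP/letter_same[e|e]; first by rewrite e eqxx in tx.
  rewrite tE transp_abs ?e //=.
    by apply: contraNneq xy => /letter_same[->//|ye]; rewrite e ye eqxx in yx'.
  by apply: contraNneq xy => /letter_same[->//|ye]; rewrite e ye eqxx in yx'.
have xx' : x.1 != x'.1 by rewrite eq_sym.
suff -> : (transp x y * t * transp x (t y))%g = transp x' (oppl x').
  by rewrite mem_transps // eq_sym oppl_neq.
have [->|yNx] := eqVneq y (oppl x).
  rewrite signedN // -/x' tE -mulgA transp_negate //.
  rewrite mulgA transp_mulC ?transp_signed // !transp_abs //.
  by rewrite -mulgA transpK mulg1.
(* The letters moved by [t] are those with the absolute values of [x] and [x'], so only this case is
   left. *)
have {}yx' : y = oppl x'.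
  apply/eqP; apply: contraNT ty => yNx'.
  by rewrite tE transpD // eq_sym.
rewrite yx' signedN // tE transpR.
have := @transp_negate x (oppl x') xx'.
by rewrite opplK => ->; rewrite -mulgA transpK mulg1 transpC.
Qed.

(* Removing [x] from its cycle costs one factor of any word for [u]. *)
Lemma transps_word_delete m u x : (u \in transps n ^+ m)%g -> u x != x ->
  exists2 m', m = m'.+1 & (u * transp x (u x) \in transps n ^+ m')%g.
Proof.
elim: m u => [|m IH] u; first by rewrite expg0 => /set1P ->; rewrite perm1 eqxx.
rewrite expgSr => /mulsgP[v t vm tT ->]; rewrite permM => tvx.
exists m => //; have [vx|vx] := eqVneq (v x) x.
  by rewrite vx in tvx *; rewrite -mulgA {1}(transps_moved tT tvx) transpK mulg1.
have [m' -> vm'] := IH v vm vx; rewrite expgSr.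
(* Two copies of [transp x (v x)] are inserted: one shortens [v], the other turns [t] into another
   single reflection. *)
have -> : (v * t * transp x (t (v x)) =
    (v * transp x (v x)) * (transp x (v x) * t * transp x (t (v x))))%g.
  by rewrite !mulgA -(mulgA v (transp x (v x))) transpK mulg1.
by apply: mem_mulg => //; apply: transps_triple => //; rewrite eq_sym.
Qed.

Lemma reflection_lengthP s : s \in signed_perms n ->
  (s \in transps n ^+ reflection_length s)%g /\
  forall m, (s \in transps n ^+ m)%g -> reflection_length s <= m.
Proof.
rewrite /reflection_length => sB; case: ex_minnP => m; rewrite sB => sm min.
by split=> // k sk; apply: min; rewrite sk.
Qed.

(** Appending the reflection once more gives one inequality; deleting [x] from a shortest word for
    [s] gives the other. *)
Lemma reflection_length_delete s x : s \in signed_perms n ->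
  reflection_length s =
  (s x != x) + reflection_length (s * transp (s x) x)%g.
Proof.
move=> sB; have [sx|sx] /= := eqVneq (s x) x.
  by rewrite sx transp_id mulg1.
have tB : (s * transp (s x) x)%g \in signed_perms n.
  by rewrite groupM ?transp_signed.
have [sl smin] := reflection_lengthP sB; have [tl tmin] := reflection_lengthP tB.
apply/eqP; rewrite eqn_leq; apply/andP; split.
  apply: smin; rewrite expgSr -[s in s \in _]mulg1 -(transpK (s x) x) mulgA.
  by apply: mem_mulg => //; apply: mem_transps.
have [m -> sm] := transps_word_delete sl sx.
by rewrite add1n ltnS; apply: tmin; rewrite transpC.
Qed.

Lemma reflection_length1 : reflection_length (1 : {perm letter n})%g = 0.
Proof.
have [_ /(_ 0)] := reflection_lengthP (group1 (signed_perms_group n)).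
by rewrite expg0 set11 => /(_ isT); rewrite leqn0 => /eqP.
Qed.

End SignedPermutations.

(** * Sorting a signed permutation towards s0 *)

Lemma signed_perms_belowP (n : nat) (r : 'I_n -> nat) (s : {perm letter n}) :
  reflect (s \in signed_perms n /\ forall x, (s x).1 < r x.1)
          (s \in signed_perms_below r).
Proof.
rewrite [X in reflect _ X]inE; apply: (iffP andP) => -[sB sr]; split=> //.
  by move=> [i b]; rewrite signed_posl //; move/forallP: sr; apply.
by apply/forallP => k; apply: sr.
Qed.

(** An injection into a set that is no larger is a bijection, so surjectivity is replaced by a
    comparison of cardinalities. *)
Lemma sum_bij_card (R : pzSemiRingType) (T U : finType) (A : {set T})
    (B : {set U}) (f : T -> U) (G : U -> R) :
  {in A &, injective f} -> {in A, forall x, f x \in B} -> #|B| <= #|A| ->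
  (\sum_(x in A) G (f x) = \sum_(y in B) G y)%R.
Proof.
move=> f_inj fAB BA; have -> : B = f @: A.
  apply/esym/eqP; rewrite eqEcard card_in_imset // BA andbT.
  by apply/subsetP => _ /imsetP[x xA ->]; apply: fAB.
by rewrite big_imset.
Qed.

Lemma signed_inv_posl (n : nat) (s : {perm letter n}) i : s \in signed_perms n ->
  s (posl ((s^-1)%g (posl i)).1) = (i, ((s^-1)%g (posl i)).2).
Proof.
move=> sB; have : s ((s^-1)%g (posl i)) = posl i by rewrite permKV.
case: ((s^-1)%g _) => j b; rewrite signed_posl //=.
by case: (s _) => l c /= [->]; case: b; case: c.
Qed.

Lemma enum_ord_ge (n : nat) (k : 'I_n) :
  [seq j : 'I_n <- enum 'I_n | k <= j] =
  k :: [seq j : 'I_n <- enum 'I_n | k < j].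
Proof.
have tr : transitive (relpre (@nat_of_ord n) ltn).
  by move=> x y z; apply: ltn_trans.
have ltE : sorted (relpre (@nat_of_ord n) ltn) (enum 'I_n).
  by rewrite -sorted_map val_enum_ord iota_ltn_sorted.
apply: (irr_sorted_eq tr) => [x| | |x]; first exact: ltnn.
- exact: sorted_filter.
- rewrite /= path_sortedE // sorted_filter // andbT.
  by apply/allP => x; rewrite mem_filter => /andP[].
rewrite in_cons !(mem_enum, mem_filter) !andbT leq_eqVlt eq_sym.
by rewrite -(inj_eq val_inj).
Qed.

(** Sorting treats the largest index first, so invariants propagate downwards from [n]. *)
Lemma ord_down_ind (n : nat) (P : nat -> Prop) :
  P n -> (forall k : 'I_n, P k.+1 -> P k) -> forall m, m <= n -> P m.
Proof.
move=> Pn step m mn; rewrite -(subKn mn).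
elim: (n - m) (leq_subr m n) => [|d IH] dn; first by rewrite subn0.
have lt : n - d.+1 < n by rewrite ltn_subrL (leq_ltn_trans _ dn).
by apply: (step (Ordinal lt)); rewrite /= subnSK //; apply/IH/ltnW.
Qed.

Lemma big_ord_ge (T : Type) (idx : T) (op : Monoid.com_law idx) (n : nat)
    (F : 'I_n -> T) (k : 'I_n) :
  \big[op/idx]_(j < n | k <= j) F j =
  op (F k) (\big[op/idx]_(j < n | k < j) F j).
Proof.
rewrite (bigD1 k) //=; congr (op _ _); apply: eq_bigl => j.
by rewrite ltn_neqAle eq_sym andbC -(inj_eq val_inj).
Qed.

Section Sorting.

Variables (n : nat) (r : 'I_n -> nat) (s0 : {perm letter n}).
Hypothesis s0_in : s0 \in signed_perms_below r.
Implicit Types (s u : {perm letter n}) (x : letter n) (k : 'I_n).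

(** The signed position of the value k in [s0], where sorting has to bring k. *)
Definition base k : letter n := (s0^-1)%g (posl k).

(** Products act from left to right, so the reflection exchanges values: k trades places with the
    entry at [base k]. *)
Definition sort_perm k s : {perm letter n} :=
  (s * transp (s (base k)) (posl k))%g.

(* The signed permutations that sorting the values at least [m] can reach. *)
Definition stage m : {set {perm letter n}} :=
  [set s in signed_perms_below r |
    [forall j : 'I_n, (m <= j) ==> (s (base j) == posl j)]].

(* The signed positions that the value [k] can occupy in [stage k.+1]. *)
Definition slots k : {set letter n} :=
  [set x : letter n | (k < r x.1) && ((s0 x).1 <= k)].

Definition sorted_above m s : {perm letter n} :=
  foldr sort_perm s [seq j : 'I_n <- enum 'I_n | m <= j].

(** The signed position of k just before its own sorting step. *)
Definition slot s k : letter n := ((sorted_above k.+1 s)^-1)%g (posl k).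

Lemma s0_signed : s0 \in signed_perms n.
Proof. by case/signed_perms_belowP: s0_in. Qed.

Lemma s0_base k : s0 (base k) = posl k.
Proof. by rewrite /base permKV. Qed.

Lemma base_slots k : base k \in slots k.
Proof.
have [_ h] := signed_perms_belowP _ _ s0_in.
by have := h (base k); rewrite inE s0_base leqnn andbT.
Qed.

Lemma stageP m s :
  reflect (s \in signed_perms_below r /\
           forall j : 'I_n, m <= j -> s (base j) = posl j) (s \in stage m).
Proof.
rewrite [X in reflect _ X]inE; apply: (iffP andP) => -[-> h]; split=> //.
  by move=> j mj; apply/eqP; move/forallP/(_ j): h; rewrite mj.
by apply/forallP => j; apply/implyP => /h ->.
Qed.

Lemma stage_step k s : (s \in stage k) =
  (s \in stage k.+1) && (s (base k) == posl k).
Proof.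
apply/stageP/andP => [[sB h]|[/stageP[sB h] /eqP sk]].
  by rewrite h ?eqxx //; split=> //; apply/stageP; split=> // j /ltnW/h.
split=> // j; rewrite leq_eqVlt => /orP[/eqP/val_inj <- //|].
exact: h.
Qed.

Lemma stage_n : stage n = signed_perms_below r.
Proof.
apply/setP => s; apply/stageP/idP => [[]//|sB]; split=> // j.
by rewrite leqNgt ltn_ord.
Qed.

(** Every letter is some [base i] or its opposite, so the values at all [base i] determine a signed
    permutation. *)
Lemma stage_0 : stage 0 = [set s0].
Proof.
apply/setP => s; rewrite in_set1; apply/stageP/eqP => [[sB h]|->]; last first.
  by split=> // j _; rewrite s0_base.
have [sS _] := signed_perms_belowP _ _ sB.
apply/permP => x; rewrite -[x](permK s0).
case: (s0 x) => i b; rewrite permKV.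
have -> : (s0^-1)%g (i, b) = if b then oppl (base i) else base i.
  case: b => //; rewrite -signedN ?(groupV (signed_perms_group n)) //.
  exact: s0_signed.
by case: b; rewrite ?signedN // h.
Qed.

(** The values above k already stand where [s0] has them, and no slot of k is such a place. *)
Lemma stage_leq k s x : s \in stage k.+1 -> x \in slots k -> (s x).1 <= k.
Proof.
move=> /stageP[/signed_perms_belowP[sB sr] h]; rewrite inE => /andP[_ xk].
rewrite leqNgt; apply/negP => kx.
have : (s x).1 == (s (base (s x).1)).1 by rewrite h.
rewrite signed_abs // -(signed_abs _ _ s0_signed) s0_base => /eqP e.
by move: xk; rewrite e leqNgt kx.
Qed.

Lemma stage_slot k s : s \in stage k.+1 -> (s^-1)%g (posl k) \in slots k.
Proof.
move=> /stageP[/signed_perms_belowP[sB sr] h]; set x := (s^-1)%g _.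
have sx : s x = posl k by rewrite permKV.
rewrite inE; have := sr x; rewrite sx => -> /=.
rewrite leqNgt; apply/negP => kx; set j := (s0 x).1 in kx.
have : x.1 == (base j).1 by rewrite -(signed_abs _ _ s0_signed) s0_base.
rewrite -(signed_abs _ _ sB) sx h //= => /eqP kj.
by rewrite -kj ltnn in kx.
Qed.

(** Slots carry values at most k and have bounds larger than k, so exchanging two of them respects
    [r]; the places of the larger values are untouched. *)
Lemma stage_transp k s x : s \in stage k.+1 -> x \in slots k ->
  (transp (base k) x * s)%g \in stage k.+1.
Proof.
move=> sk xk; have [/signed_perms_belowP[sB sr] h] := stageP _ _ sk.
have leq_slot y z : y \in slots k -> z \in slots k -> (s y).1 < r z.1.
  move=> /(stage_leq sk) yk; rewrite inE => /andP[zk _].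
  exact: leq_ltn_trans yk zk.
have bk := base_slots k.
apply/stageP; split; last first.
  move=> j kj; rewrite permM transp_abs ?h //.
    rewrite -(signed_abs _ _ s0_signed) !s0_base /=.
    by apply: contraTneq kj => ->; rewrite ltnn.
  rewrite -(signed_abs _ _ s0_signed) s0_base /=; move: xk; rewrite inE.
  by move=> /andP[_]; rewrite leqNgt; apply: contraNneq => <-.
apply/signed_perms_belowP; split.
  by rewrite (groupM (G := signed_perms_group n)) ?transp_signed.
have tB := transp_signed (base k) x.
move=> y; have [/letter_same e|yb] := eqVneq y.1 (base k).1.
  have -> : ((transp (base k) x * s)%g y).1 = (s x).1.
    by case: e => ->; rewrite permM ?signedN // transpL.
  have -> : y.1 = (base k).1 by case: e => ->.
  exact: leq_slot.
have [/letter_same e|yx] := eqVneq y.1 x.1.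
  have -> : ((transp (base k) x * s)%g y).1 = (s (base k)).1.
    by case: e => ->; rewrite permM ?signedN // transpR.
  have -> : y.1 = x.1 by case: e => ->.
  exact: leq_slot.
by rewrite permM transp_abs.
Qed.

(** Exchanging two values is the same as exchanging the positions that hold them. *)
Lemma sort_permE k s : s \in signed_perms n ->
  sort_perm k s = (transp (base k) ((s^-1)%g (posl k)) * s)%g.
Proof. by move=> sB; rewrite transp_mulC // permKV. Qed.

Lemma sort_perm_stage k s : s \in stage k.+1 -> sort_perm k s \in stage k.
Proof.
move=> sk; have [/signed_perms_belowP[sB _] _] := stageP _ _ sk.
rewrite stage_step {2}/sort_perm permM transpL eqxx andbT sort_permE //.
by rewrite stage_transp ?stage_slot.
Qed.

Lemma sorted_above_step k s :
  sorted_above k s = sort_perm k (sorted_above k.+1 s).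
Proof. by rewrite /sorted_above enum_ord_ge. Qed.

Lemma sorted_above_n s : sorted_above n s = s.
Proof.
rewrite /sorted_above (eq_filter (a2 := pred0)) ?filter_pred0 //.
by move=> j; rewrite leqNgt ltn_ord.
Qed.

Lemma sorted_above_stage m s : m <= n ->
  s \in signed_perms_below r -> sorted_above m s \in stage m.
Proof.
move=> mn sB; move: m mn; apply: ord_down_ind.
  by rewrite sorted_above_n stage_n.
by move=> k; rewrite sorted_above_step; apply: sort_perm_stage.
Qed.

(** Sorting k splits [s] into the slot of k and the sorted permutation; multiplying by
    [transp (base k) x] recovers [s], so this is a bijection onto pairs. *)
Lemma sum_stage_step (R : pzSemiRingType) k (c : letter n -> R)
    (G : {perm letter n} -> R) :
  (\sum_(s in stage k.+1) c ((s^-1)%g (posl k)) * G (sort_perm k s) =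
   (\sum_(x in slots k) c x) * \sum_(s in stage k) G s)%R.
Proof.
rewrite big_distrlr /= pair_big_dep /=.
rewrite [RHS](reindex_onto (fun s => ((s^-1)%g (posl k), sort_perm k s))
  (fun p => (transp (base k) p.1 * p.2)%g)) /=; last first.
  move=> [x s] /= /andP[xk]; rewrite stage_step => /andP[sk /eqP sb].
  have [/signed_perms_belowP[sB _] _] := stageP _ _ sk.
  have e : ((transp (base k) x * s)^-1)%g (posl k) = x.
    by rewrite invMg transpV permM -sb permK transpL.
  rewrite sort_permE ?e ?mulgA ?transpK ?mul1g //.
  by rewrite (groupM (G := signed_perms_group n)) ?transp_signed.
apply: eq_bigl => s; apply/idP/andP => [sk|[/andP[xk sk] /eqP e]].
  have [/signed_perms_belowP[sB _] _] := stageP _ _ sk.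
  by rewrite stage_slot // sort_perm_stage // sort_permE // mulgA transpK mul1g.
rewrite -e; apply: stage_transp => //.
by move: sk; rewrite stage_step => /andP[].
Qed.

Lemma sum_slots (R : comPzSemiRingType) (c : 'I_n -> letter n -> R) :
  (\sum_(s in signed_perms_below r) \prod_(k < n) c k (slot s k) =
   \prod_(k < n) \sum_(x in slots k) c k x)%R.
Proof.
(* [G] stays arbitrary because each downward step absorbs the weight of one more slot into it. *)
have main m : m <= n -> forall G : {perm letter n} -> R,
  (\sum_(s in signed_perms_below r)
      (\prod_(k < n | (m <= k)%N) c k (slot s k)) * G (sorted_above m s) =
   (\prod_(k < n | (m <= k)%N) \sum_(x in slots k) c k x) *
      \sum_(s in stage m) G s)%R.
  move: m; apply: ord_down_ind => [|k IH] G.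
    have big0 (F : 'I_n -> R) : (\prod_(k < n | (n <= k)%N) F k = 1)%R.
      by rewrite big_pred0 // => k; rewrite leqNgt ltn_ord.
    rewrite stage_n big0 GRing.mul1r.
    by apply: eq_bigr => s _; rewrite big0 GRing.mul1r sorted_above_n.
  rewrite big_ord_ge /= [(X in (X * _)%R)]GRing.mulrC -GRing.mulrA.
  rewrite -sum_stage_step -IH.
  apply: eq_bigr => s _; rewrite big_ord_ge /= sorted_above_step.
  by rewrite [(X in (X * _)%R)]GRing.mulrC GRing.mulrA.
have := main 0 (leq0n n) (fun => 1%R); rewrite stage_0 big_set1 GRing.mulr1 => <-.
by apply: eq_bigr => s _; rewrite GRing.mulr1.
Qed.

Lemma card_signed_perms_below :
  #|signed_perms_below r| = \prod_(k < n) #|slots k|.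
Proof.
transitivity (\prod_(k < n) \sum_(x in slots k) 1).
  rewrite -(sum_slots (R := nat) (fun _ _ => 1)).
  by rewrite -sum1_card; apply: eq_bigr => s _; rewrite big1.
by apply: eq_bigr => k _; rewrite sum1_card.
Qed.

(** Each sorting step deletes k from its cycle in [s0^-1 * s], which lowers the length by one unless
    k is already at [base k]. *)
Lemma reflection_length_slots s : s \in signed_perms_below r ->
  reflection_length (s0^-1 * s)%g = \sum_(k < n) (slot s k != base k).
Proof.
move=> sB; have s0V := s0_signed; rewrite -(groupV (signed_perms_group n)) in s0V.
have main m : m <= n -> reflection_length (s0^-1 * s)%g =
  (\sum_(k < n | m <= k) (slot s k != base k)) +
  reflection_length (s0^-1 * sorted_above m s)%g.
  move: m; apply: ord_down_ind => [|k ->].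
    by rewrite sorted_above_n big_pred0 // => k; rewrite leqNgt ltn_ord.
  have /stageP[/signed_perms_belowP[uB _] _] :=
    sorted_above_stage (ltn_ord k) sB.
  rewrite big_ord_ge /=; set u := sorted_above k.+1 s in uB *.
  have -> : (slot s k != base k) = (u (base k) != posl k).
    by rewrite /slot -(inj_eq (@perm_inj _ u)) permKV eq_sym.
  rewrite (reflection_length_delete (posl k)); last first.
    by rewrite (groupM (G := signed_perms_group n)).
  by rewrite permM -/(base k) sorted_above_step /sort_perm mulgA addnCA addnA.
rewrite (main 0) //.
have := sorted_above_stage (leq0n n) sB; rewrite stage_0 => /set1P ->.
by rewrite mulVg reflection_length1 addn0.
Qed.

End Sorting.

(** * Sorting a bicolored matching *)

Lemma sint_lt0 (n : nat) (s : {perm letter n}) (i : 'I_n) :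
  (sint s i < 0)%R = (s (posl i)).2.
Proof. by rewrite /sint /letter_int /letter_abs; case: (s _) => j [|]. Qed.

(* Elements of [S] in the cyclic interval from [x] to [y]; the strict bounds in
   the second case are those of the sorting index. *)
Definition arc (m : nat) (S : {set 'I_m}) (y x : 'I_m) : nat :=
  if x <= y then #|[set c in S | x <= c <= y]|
  else #|[set c in S | ~~ (y < c < x)]|.

Lemma arc_leq (m : nat) (S : {set 'I_m}) (y x : 'I_m) : arc S y x <= #|S|.
Proof.
by rewrite /arc; case: ifP => _; apply: subset_leq_card; apply/subsetP => c;
  rewrite inE => /andP[].
Qed.

Lemma arc_base (m : nat) (S : {set 'I_m}) (y : 'I_m) : y \notin S -> arc S y y = 0.
Proof.
move=> yS; rewrite /arc leqnn; apply/eqP; rewrite cards_eq0; apply/eqP/setP => c.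
rewrite !inE -eqn_leq; apply: contraNF yS => /andP[cS /eqP yc].
by rewrite (val_inj yc).
Qed.

(** The count grows strictly as [x] moves left from [y] through [S], wraps around to the largest
    vertex, and continues left down to [y]. *)
Lemma arc_inj (m : nat) (S : {set 'I_m}) (y : 'I_m) : y \notin S ->
  {in y |: S &, injective (arc S y)}.
Proof.
move=> yS; have lt (x1 x2 : 'I_m) : x1 \in y |: S -> x2 \in y |: S -> x1 < x2 ->
    arc S y x1 != arc S y x2.
  rewrite !inE => x1S x2S x12; rewrite /arc.
  have [x2y|x2y] := leqP x2 y.
    rewrite (leq_trans (ltnW x12) x2y) gtn_eqF //; apply/proper_card/properP.
    split; first by apply/subsetP => c; rewrite !inE => /andP[-> /=]; lia.
    exists x1; rewrite !inE; last by lia.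
    by case/orP: x1S => [/eqP ?|->]; subst; lia.
  have {}x2S : x2 \in S.
    by case/orP: x2S => [/eqP ?|//]; subst; lia.
  have [x1y|x1y] := leqP x1 y.
    rewrite ltn_eqF //; apply/proper_card/properP.
    split; first by apply/subsetP => c; rewrite !inE => /andP[-> /=]; lia.
    by exists x2; rewrite !inE ?x2S /=; lia.
  have {}x1S : x1 \in S.
    by case/orP: x1S => [/eqP ?|//]; subst; lia.
  rewrite gtn_eqF //; apply/proper_card/properP.
  split; first by apply/subsetP => c; rewrite !inE => /andP[-> /=]; lia.
  by exists x1; rewrite !inE ?x1S /=; lia.
move=> x1 x2 x1S x2S e; apply: val_inj; case: (ltngtP x1 x2) => // h.
  by have := lt _ _ x1S x2S h; rewrite e eqxx.
by have := lt _ _ x2S x1S h; rewrite e eqxx.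
Qed.

(** * Signed permutations and their matchings *)

Section Matchings.

Variables (n : nat) (r : 'I_n -> nat).
Hypothesis r_mono : forall i j : 'I_n, i <= j -> r i <= r j.
Hypothesis r_len : forall k : 'I_n, r k <= n.
Hypothesis r_gek : forall k : 'I_n, k < r k.
Implicit Types (s : {perm letter n}) (i j k : 'I_n).

Local Notation D := (dyck_of r).
Local Notation M := (matching_of r).

Let hD : count id D = n := dyck_of_count r_mono r_len.

Lemma count_take_closer k : count id (take (closer D k) D) = r k.
Proof.
have /andP[_ /forallP/(_ k)/eqP//] : is_dyck D && falls_preceded_by r D.
by rewrite dyck_ofP.
Qed.

(** Compare the numbers of rises before the two vertices: i before the opener and [r k] before the
    closer. *)
Lemma opener_lt_closer i k : (opener D i < closer D k) = (i < r k).
Proof.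
have [Di ti] := openerP i hD; rewrite -(count_take_closer k).
apply/idP/idP => [lt|].
  apply: leq_trans (count_take_mono id D lt).
  by rewrite (take_nth false) ?size_tuple // -tnth_nth Di -cats1 count_cat ti addn1.
move=> lt; rewrite ltnNge; apply: contraTN lt => le; rewrite -leqNgt -ti.
exact: count_take_mono.
Qed.

Lemma opener_lt i j : (opener D i < opener D j) = (i < j).
Proof.
have homo k l : opener D k < opener D l -> k < l.
  have [Dk tk] := openerP k hD; have [_ tl] := openerP l hD => lt.
  rewrite -tk -tl; apply: leq_trans (count_take_mono id D lt).
  by rewrite (take_nth false) ?size_tuple // -tnth_nth Dk -cats1 count_cat addn1.
apply/idP/idP => [/homo//|]; apply: contraTT; rewrite -!leqNgt leq_eqVlt.
by case/orP=> [/eqP/val_inj/(opener_inj hD) ->|/homo/ltnW].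
Qed.

Lemma opener_mem_edge s i k :
  (opener D i \in matching_edge D s k) = (i == (s (posl k)).1).
Proof.
by rewrite !inE opener_neq_closer // orbF (inj_eq (opener_inj hD)).
Qed.

Lemma closer_mem_edge s i k : (closer D i \in matching_edge D s k) = (i == k).
Proof.
by rewrite !inE eq_sym opener_neq_closer // (inj_eq (closer_inj hD)).
Qed.

Lemma matching_edge_inj s : injective (matching_edge D s).
Proof.
move=> k l kl; have := closer_mem_edge s k k.
by rewrite kl closer_mem_edge eqxx => /eqP.
Qed.

Section Below.

Variable s : {perm letter n}.
Hypothesis sr : s \in signed_perms_below r.

Let sB : s \in signed_perms n.
Proof. by have [] := signed_perms_belowP _ _ sr. Qed.

Lemma pblock_matching v k :
  v \in matching_edge D s k -> pblock (edges (M s)) v = matching_edge D s k.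
Proof.
have /and4P[/and3P[_ ti _] _ _ _] := matching_ofP r_mono r_len r_gek sr.
by apply: def_pblock ti _; apply: imset_f.
Qed.

Lemma mate_opener k : mate (M s) (opener D (s (posl k)).1) = closer D k.
Proof.
apply: mateE; first by rewrite opener_neq_closer.
by apply: (@pblock_matching _ k); rewrite opener_mem_edge.
Qed.

Lemma mate_closer k : mate (M s) (closer D k) = opener D (s (posl k)).1.
Proof.
apply: mateE; first by rewrite eq_sym opener_neq_closer.
by rewrite (@pblock_matching _ k) ?closer_mem_edge // /matching_edge setUC.
Qed.

Lemma mate_opener_letter x : mate (M s) (opener D (s x).1) = closer D x.1.
Proof. by case: x => i b; rewrite signed_posl // mate_opener. Qed.

Lemma col_opener k : Defs.col (M s) (opener D (s (posl k)).1) = (s (posl k)).2.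
Proof.
rewrite /Defs.col (@pblock_matching _ k) ?opener_mem_edge //.
apply/imsetP/idP => [[j]|sk].
  by rewrite inE sint_lt0 => sj /matching_edge_inj ->.
by exists k; rewrite // inE sint_lt0.
Qed.

End Below.

(** Closers are positions and openers are values, so re-pairing the closers of [base s0 k] and of
    the slot of k is the exchange of these two positions. Colours add modulo 2 as signs multiply. *)
Lemma sort_step_matching s s0 k :
  s \in signed_perms_below r -> s0 \in signed_perms_below r ->
  (forall i, (base s0 i).2 = false) ->
  sort_step D (M s0) k (M s) = M (sort_perm s0 k s).
Proof.
move=> sr s0r s0_pos; have [sB _] := signed_perms_belowP _ _ sr.
rewrite sort_permE //; set b := base s0 k.
set x := (s^-1)%g (posl k); set s' := (transp b x * s)%g.
have sx : s x = posl k by rewrite /x permKV.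
have bE : b = posl b.1 by rewrite [LHS]surjective_pairing /b s0_pos.
have s'B : s' \in signed_perms n.
  by rewrite (groupM (G := signed_perms_group n)) ?transp_signed.
have s'b : s' (posl b.1) = posl k by rewrite -bE permM transpL.
have s'x : s' x = s (posl b.1) by rewrite permM transpR -bE.
have s'D j : j != b.1 -> j != x.1 -> s' (posl j) = s (posl j).
  by move=> jb jx; rewrite permM transp_abs.
have sxE : s (posl x.1) = (k, x.2) by rewrite signed_inv_posl.
have sx1 : (s (posl x.1)).1 = k by rewrite sxE.
have mk : mate (M s) (opener D k) = closer D x.1.
  by rewrite -{1}sx1 mate_opener.
have mk0 : mate (M s0) (opener D k) = closer D b.1.
  by have := mate_opener_letter s0r b; rewrite /b {1}/base permKV.
have pk : pblock (edges (M s)) (opener D k) = matching_edge D s x.1.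
  by apply: pblock_matching => //; rewrite opener_mem_edge sx1.
rewrite /sort_step mk mk0 (inj_eq (closer_inj hD)).
(* Here k is at its final position up to sign: the edges stay, and only the edge at the opener of k
   turns red. *)
have [xb|xb] := eqVneq x.1 b.1.
  have s's j : (s' (posl j)).1 = (s (posl j)).1.
    have [->|jb] := eqVneq j b.1; first by rewrite s'b -xb sx1.
    by rewrite s'D // xb.
  have eE : matching_edge D s' =1 matching_edge D s.
    by move=> j; rewrite /matching_edge s's.
  rewrite /M; congr BiMatching; first by apply: eq_imset => j; rewrite eE.
  rewrite pk; apply/setP => e; rewrite in_setD1; apply/andP/imsetP.
    case=> ex /imsetP[j]; rewrite inE sint_lt0 => sj ej.
    have jx : j != x.1 by apply: contraNneq ex => <-; apply/eqP.
    by exists j; rewrite ?eE // inE sint_lt0 s'D // -xb.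
  case=> j; rewrite inE sint_lt0 => sj ->.
  have jx : j != x.1 by apply: contraTneq sj => ->; rewrite xb s'b.
  rewrite eE (inj_eq (@matching_edge_inj s)) jx; split=> //.
  by apply/imset_f; rewrite inE sint_lt0 -s'D // -xb.
rewrite mate_closer //.
have ->: [set opener D k; closer D b.1] = matching_edge D s' b.1.
  by rewrite /matching_edge s'b.
have s'xE : ((s' (posl x.1)).1, (s' (posl x.1)).2 (+) x.2) = s (posl b.1).
  by rewrite -s'x -signed_posl // -surjective_pairing.
have s'x1 : (s' (posl x.1)).1 = (s (posl b.1)).1 by rewrite -s'xE.
have s'x2 : (s' (posl x.1)).2 = (s (posl b.1)).2 (+) x.2.
  by rewrite -s'xE -addbA addbb addbF.
have ->: [set opener D (s (posl b.1)).1; closer D x.1] = matching_edge D s' x.1.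
  by rewrite /matching_edge s'x1.
have ->: [set opener D k; closer D x.1] = matching_edge D s x.1.
  by rewrite /matching_edge sx1.
rewrite -/(matching_edge D s b.1).
(* Only the edges at the closers [b.1] and [x.1] differ between [s] and [s']. *)
set E := _ :|: _; have EE : E = edges (M s').
  apply/setP => e; rewrite !inE; apply/idP/imsetP.
    case/orP=> [/orP[]/eqP->|/andP[]]; [by exists b.1|by exists x.1|].
    rewrite negb_or => /andP[ex eb] /imsetP[j _ ej].
    exists j => //; rewrite ej /matching_edge s'D //.
      by apply: contraNneq eb => <-; apply/eqP.
    by apply: contraNneq ex => <-; apply/eqP.
  case=> j _ ->; have [->|jb] := eqVneq j b.1; first by rewrite eqxx.
  have [->|jx] := eqVneq j x.1; first by rewrite eqxx orbT.
  have -> : matching_edge D s' j = matching_edge D s j.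
    by rewrite /matching_edge s'D.
  apply/orP; right; rewrite !(inj_eq (@matching_edge_inj s)) negb_or jx jb.
  by apply/andP; split=> //; apply: imset_f.
rewrite EE; congr BiMatching; apply/setP => e; rewrite inE.
(* The edge at the opener of k has colour [x.2]: added to itself it gives red, and added to the
   other re-paired edge it gives the sign in [s'x2]. *)
have newcolE j : (if opener D (s' (posl j)).1 \in
      [set opener D k; opener D (s (posl b.1)).1]
    then Defs.col (M s) (opener D (s' (posl j)).1) (+) Defs.col (M s) (opener D k)
    else Defs.col (M s) (opener D (s' (posl j)).1)) = (s' (posl j)).2.
  have colk : Defs.col (M s) (opener D k) = x.2.
    by rewrite -{1}sx1 col_opener // sxE.
  rewrite !inE !(inj_eq (opener_inj hD)) colk.
  have [->|jb] := eqVneq j b.1; first by rewrite s'b eqxx /= colk addbb.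
  have [->|jx] := eqVneq j x.1.
    by rewrite s'x1 eqxx orbT col_opener // s'x2.
  rewrite s'D // -{1}sx1 !signed_abs //= (negPf jx) (negPf jb) /=.
  by rewrite col_opener.
apply/andP/imsetP.
  case=> /imsetP[j _ ->] /existsP[i /andP[]]; rewrite opener_mem_edge => /eqP ->.
  by rewrite newcolE => sj; exists j; rewrite // inE sint_lt0.
case=> j; rewrite inE sint_lt0 => sj ->; split; first exact: imset_f.
apply/existsP; exists (s' (posl j)).1.
by rewrite opener_mem_edge eqxx newcolE.
Qed.

Lemma sort_state_matching s s0 k :
  s \in signed_perms_below r -> s0 \in signed_perms_below r ->
  (forall i, (base s0 i).2 = false) ->
  sort_state D (M s) (M s0) k = M (sorted_above s0 k.+1 s).
Proof.
move=> sr s0r s0_pos; rewrite /sort_state.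
suff main m : m <= n -> foldr (sort_step D (M s0)) (M s)
    [seq j : 'I_n <- enum 'I_n | m <= j] = M (sorted_above s0 m s).
  exact: (main k.+1).
move: m; apply: ord_down_ind => [|{}k IH].
  rewrite sorted_above_n (eq_filter (a2 := pred0)) ?filter_pred0 //.
  by move=> j; rewrite leqNgt ltn_ord.
rewrite enum_ord_ge /= IH sorted_above_step sort_step_matching //.
by have /stageP[] := sorted_above_stage s0r (ltn_ord k) sr.
Qed.

(** * The code of a slot *)

Definition earlier_closers s0 k : {set 'I_(n + n)} :=
  [set c : 'I_(n + n) | (opener D k < c) && (mate (M s0) c < opener D k)].

(* The paper's a_(k+1), as a function of the signed position of the value [k]. *)
Definition slot_code s0 k (x : letter n) : nat :=
  arc (earlier_closers s0 k) (closer D (base s0 k).1) (closer D x.1).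

Lemma sor_at_slot s s0 k :
  s \in signed_perms_below r -> s0 \in signed_perms_below r ->
  (forall i, (base s0 i).2 = false) ->
  sor_at D (M s) (M s0) k =
  if (slot s0 s k).2 then 2 * k.+1 - 1 - slot_code s0 k (slot s0 s k)
  else slot_code s0 k (slot s0 s k).
Proof.
move=> sr s0r s0_pos; rewrite /sor_at /sor_count sort_state_matching //.
have /stageP[ur _] := sorted_above_stage s0r (ltn_ord k) sr.
have [uB _] := signed_perms_belowP _ _ ur.
set u := sorted_above _ _ _ in ur uB *.
have uE : u (posl (slot s0 s k).1) = (k, (slot s0 s k).2).
  exact: signed_inv_posl.
have -> : Defs.col (M u) (opener D k) = (slot s0 s k).2.
  by have := col_opener ur (slot s0 s k).1; rewrite uE.
have -> : mate (M u) (opener D k) = closer D (slot s0 s k).1.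
  by have := mate_opener ur (slot s0 s k).1; rewrite uE.
have -> : mate (M s0) (opener D k) = closer D (base s0 k).1.
  by have := mate_opener_letter s0r (base s0 k); rewrite /base permKV.
suff -> : (if closer D (slot s0 s k).1 <= closer D (base s0 k).1
  then #|[set c : 'I_(n + n) | [&& opener D k < c,
    closer D (slot s0 s k).1 <= c <= closer D (base s0 k).1 &
    mate (M s0) c < opener D k]]|
  else #|[set c : 'I_(n + n) | [&& opener D k < c,
    ~~ (closer D (base s0 k).1 < c < closer D (slot s0 s k).1) &
    mate (M s0) c < opener D k]]|) = slot_code s0 k (slot s0 s k) by [].
rewrite /slot_code /arc; case: ifP => _; apply: eq_card => c;
  by rewrite !inE -[RHS]andbA [X in _ = _ && X]andbC.
Qed.

(** The bound [k < r x.1] puts the closer after the opener of k; [(s0 x).1 <= k] puts its mate in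
    the reference matching at or before that opener, with equality only for the base. *)
Lemma slots_earlier_closers s0 k x : s0 \in signed_perms_below r ->
  x \in slots r s0 k ->
  closer D x.1 \in closer D (base s0 k).1 |: earlier_closers s0 k.
Proof.
move=> s0r; have [s0B _] := signed_perms_belowP _ _ s0r.
rewrite !inE => /andP[kr xk]; rewrite (inj_eq (closer_inj hD)).
rewrite -(signed_abs _ _ s0B) s0_base opener_lt_closer kr mate_closer //=.
have -> : (s0 (posl x.1)).1 = (s0 x).1 by apply/eqP; rewrite signed_abs.
by rewrite opener_lt -leq_eqVlt.
Qed.

Lemma base_notin_earlier s0 k : s0 \in signed_perms_below r ->
  closer D (base s0 k).1 \notin earlier_closers s0 k.
Proof.
move=> s0r; have [s0B _] := signed_perms_belowP _ _ s0r.
rewrite inE mate_closer // opener_lt.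
suff -> : (s0 (posl (base s0 k).1)).1 = k by rewrite ltnn andbF.
by rewrite signed_inv_posl.
Qed.

(** The code determines the position up to sign; the colour supplies the sign. *)
Lemma slot_code_inj s0 k x y : s0 \in signed_perms_below r ->
  x \in slots r s0 k -> y \in slots r s0 k ->
  slot_code s0 k x = slot_code s0 k y -> x.1 = y.1.
Proof.
move=> s0r /(slots_earlier_closers s0r) xS /(slots_earlier_closers s0r) yS.
by move/(arc_inj (base_notin_earlier k s0r) xS yS)/(closer_inj hD).
Qed.

Lemma slot_code_eq0 s0 k x : s0 \in signed_perms_below r ->
  x \in slots r s0 k -> (slot_code s0 k x == 0) = (x.1 == (base s0 k).1).
Proof.
move=> s0r xk.
have b0 : slot_code s0 k (base s0 k) = 0 by apply/arc_base/base_notin_earlier.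
apply/eqP/eqP => [x0|e]; last by rewrite /slot_code e.
apply: (slot_code_inj s0r xk (base_slots s0r k)); by rewrite b0.
Qed.

(** This is h_(k+1) for the 0-based k, hence [k.+1] and [r p <= k] in place of k and a strict
    inequality. *)
Definition heights k : nat := k.+1 - #|[set p : 'I_n | r p <= k]|.

Lemma card_signed_lt s m : s \in signed_perms n -> m <= n ->
  #|[set p : 'I_n | (s (posl p)).1 < m]| = m.
Proof.
move=> sB mn; have s_inj : injective (fun p : 'I_n => (s (posl p)).1).
  by move=> p p' /eqP; rewrite signed_abs // => /eqP.
transitivity (\sum_(i < m) 1); last by rewrite sum_nat_const card_ord muln1.
by rewrite -sum1dep_card (big_ord_widen n (fun _ => 1)) // [RHS](reindex_inj s_inj).
Qed.

(** Exactly [k.+1] positions carry values at most k, and every position with [r p <= k] is among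
    them; the count does not depend on [s]. *)
Lemma card_available s k : s \in signed_perms_below r ->
  #|[set p : 'I_n | (k < r p) && ((s (posl p)).1 <= k)]| = heights k.
Proof.
move=> sr; have [sB sbelow] := signed_perms_belowP _ _ sr.
rewrite /heights -[X in X - _](card_signed_lt sB (ltn_ord k)).
set A := [set p : 'I_n | _ < k.+1]; set B := [set p | r p <= k].
have BA : B \subset A.
  apply/subsetP => p; rewrite !inE => /(leq_trans (sbelow (posl p))) h.
  exact: leqW.
rewrite -cardsDS //; apply: eq_card => p.
by rewrite !inE -ltnNge ltnS.
Qed.

Lemma card_slots s0 k : s0 \in signed_perms_below r ->
  #|slots r s0 k| = heights k * 2.
Proof.
move=> s0r; have [s0B _] := signed_perms_belowP _ _ s0r.
rewrite -(card_available k s0r) -card_bool -cardsT -cardsX.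
apply: eq_card => x; rewrite !inE andbT; congr (_ && (_ <= _)).
by congr (nat_of_ord _); apply/eqP; rewrite signed_abs.
Qed.

(** The counted vertices are closers of available positions other than the base, which is itself
    available; this makes the bound strict. *)
Lemma slot_code_lt s0 k x : s0 \in signed_perms_below r ->
  slot_code s0 k x < heights k.
Proof.
move=> s0r; apply: leq_ltn_trans (arc_leq _ _ _) _.
set P := [set p : 'I_n | (k < r p) && ((s0 (posl p)).1 <= k)].
have bP : (base s0 k).1 \in P.
  have [s0B _] := signed_perms_belowP _ _ s0r.
  have := base_slots s0r k; rewrite !inE => /andP[-> _] /=.
  by rewrite signed_inv_posl.
rewrite -(card_available k s0r) -/P (cardsD1 (base s0 k).1) bP add1n ltnS.
rewrite -(card_imset _ (closer_inj hD)); apply/subset_leq_card/subsetP => c.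
rewrite inE => /andP[kc ck].
(* A rise is impossible: its mate lies to its right, not before the opener of k. *)
have [/(riseE hD)[i ci]|/(fallE hD)[p cp]] := boolP (tnth D c).
  move: ck; have := mate_opener_letter s0r (base s0 i).
  rewrite s0_base -ci => -> /ltn_trans/(_ kc).
  have := base_slots s0r i; rewrite inE => /andP[ir _].
  by rewrite ci ltnNge ltnW // opener_lt_closer.
move: kc ck; rewrite cp opener_lt_closer mate_closer // opener_lt => kp pk.
apply: imset_f; rewrite !inE kp (ltnW pk) !andbT.
apply: contraTneq pk => ->; have [s0B _] := signed_perms_belowP _ _ s0r.
by rewrite signed_inv_posl // ltnn.
Qed.

End Matchings.

(** * Inversions *)

Section Inversions.

Variable n : nat.
Implicit Types (s u : {perm letter n}) (i j k : 'I_n).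

Definition smaller_after s k : nat :=
  #|[set j : 'I_n | (((s^-1)%g (posl k)).1 < j) && ((s (posl j)).1 < k)]|.

Lemma smaller_after_posl s i : s \in signed_perms n ->
  smaller_after s (s (posl i)).1 =
  \sum_(j < n) ((i < j) && ((s (posl j)).1 < (s (posl i)).1)).
Proof.
move=> sB; rewrite /smaller_after -sum1dep_card big_mkcond /=.
apply: eq_bigr => j _; set p := (s^-1)%g _; suff -> : p.1 = i by case: ifP.
by apply/eqP; rewrite -(signed_abs _ (posl i) sB) permKV.
Qed.

Lemma sum_positions s (F : 'I_n -> bool -> nat) : s \in signed_perms n ->
  \sum_(i < n) F (s (posl i)).1 (s (posl i)).2 =
  \sum_(k < n) F k ((s^-1)%g (posl k)).2.
Proof.
move=> sB; rewrite (reindex_inj (h := fun k => ((s^-1)%g (posl k)).1)).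
  by apply: eq_bigr => k _; rewrite signed_inv_posl.
move=> k l /eqP; rewrite signed_abs ?(groupV (signed_perms_group n)) //.
by move/eqP.
Qed.

Lemma Nneg_sum s : Nneg s = \sum_(i < n) (s (posl i)).2.
Proof.
rewrite /Nneg -sum1dep_card big_mkcond; apply: eq_bigr => i _.
by rewrite sint_lt0; case: ifP.
Qed.

Lemma inv_pairs (P : 'I_n -> 'I_n -> bool) :
  #|[set p : 'I_n * 'I_n | (p.1 < p.2) && P p.1 p.2]| =
  \sum_(i < n) \sum_(j < n) ((i < j) && P i j).
Proof.
rewrite -sum1dep_card pair_bigA big_mkcond /=.
by apply: eq_bigr => p _; case: ifP.
Qed.

(** Let d and e count the smaller absolute values after and before a value v, so d + e = v. A
    positive entry contributes d; a negative one contributes d + 2e + 1 = 2(v + 1) - 1 - d. *)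
Lemma invB_slots s : s \in signed_perms n ->
  invB s = \sum_(k < n) if ((s^-1)%g (posl k)).2
    then 2 * k.+1 - 1 - smaller_after s k else smaller_after s k.
Proof.
move=> sB; rewrite -(sum_positions
  (fun k b => if b then 2 * k.+1 - 1 - smaller_after s k else smaller_after s k)) //.
pose v i := (s (posl i)).1; pose b i := (s (posl i)).2.
pose e i := \sum_(j < n) ((j < i) && (v j < v i)).
have v_inj i j : i != j -> v i != v j by rewrite -(signed_abs (posl i) (posl j) sB).
have de i : smaller_after s (v i) + e i = v i.
  rewrite smaller_after_posl // -big_split /=.
  rewrite -[RHS](card_signed_lt sB (ltnW (ltn_ord (v i)))).
  rewrite -sum1dep_card [RHS]big_mkcond /=.
  apply: eq_bigr => j _; rewrite -/(v i) -/(v j).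
  by case: (ltngtP i j) => [ij|ij|/val_inj->]; rewrite ?ltnn //=; case: (_ < _).
rewrite /invB (inv_pairs (fun i j => sint s i > sint s j)%R).
rewrite (inv_pairs (fun i j => - sint s i > sint s j)%R) Nneg_sum.
rewrite -big_split /=.
(* For i < j, exactly one of the two inequalities holds if [v j < v i]; if [v i < v j], both hold
   when the entry at j is negative and neither otherwise. *)
transitivity (\sum_(i < n) smaller_after s (v i) +
    \sum_(i < n) \sum_(j < n) 2 * [&& b j, i < j & v i < v j] +
    \sum_(i < n) (s (posl i)).2).
  congr (_ + _); rewrite -big_split; apply: eq_bigr => i _ /=.
  rewrite smaller_after_posl // -!big_split; apply: eq_bigr => j _ /=.
  rewrite -/(v i) -/(v j) /sint /letter_int /letter_abs.
  rewrite -/(v i) -/(v j) -/(b i) -/(b j).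
  have [ij|ij] := ltnP i j; last by rewrite /= andbF.
  have := v_inj i j; rewrite neq_ltn ij -(inj_eq val_inj) /= => /(_ isT).
  by case: (b i) (b j) => [] []; lia.
(* Interchanging the sums charges each double contribution to the negative entry on the right of its
   pair. *)
rewrite [X in _ + X + _]exchange_big -!big_split; apply: eq_bigr => i _ /=.
have := de i; rewrite -big_distrr /= -/(v i) -/(b i).
have -> : \sum_(j < n) [&& b i, j < i & v j < v i] = b i * e i.
  by rewrite /e big_distrr; apply: eq_bigr => j _; rewrite /= mulnb.
by case: (b i); lia.
Qed.

Lemma letter_int_norm (x : letter n) : (`|letter_int x| = x.1.+1%:Z :> int)%R.
Proof. by rewrite /letter_int; case: x.2; rewrite ?Num.Theory.normrN. Qed.

(** The first set in [nminB] contains only positive entries and [Nneg] counts the negative ones, so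
    the two counts merge into a disjunction. *)
Lemma nminB_slots s : s \in signed_perms n ->
  nminB s = \sum_(k < n) (((s^-1)%g (posl k)).2 || (smaller_after s k != 0)).
Proof.
move=> sB; rewrite -(sum_positions (fun k b => b || (smaller_after s k != 0))) //.
rewrite /nminB Nneg_sum -sum1dep_card big_mkcond -big_split.
apply: eq_bigr => i _ /=; set v := (s (posl i)).1; set b := (s (posl i)).2.
have -> : [exists j : 'I_n, (i < j) && (sint s i > `|sint s j|)%R] =
    ~~ b && (smaller_after s v != 0).
  rewrite -lt0n smaller_after_posl //.
  apply/existsP/andP => [[j /andP[ij sij]]|[bN]].
    have [bN jv] : ~~ b /\ (s (posl j)).1 < v.
      move: sij; rewrite /sint letter_int_norm /letter_int /letter_abs -/v -/b.
      by case: b; lia.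
    by split=> //; rewrite (bigD1 j) //= ij jv.
  rewrite lt0n sum_nat_eq0 negb_forall => /existsP[j].
  rewrite /= eqb0 negbK => /andP[ij jv]; exists j; rewrite ij /=.
  move: jv bN; rewrite /sint letter_int_norm /letter_int /letter_abs -/v -/b.
  by case: b => // jv _; rewrite ltz_nat.
by case: b; case: (_ != 0).
Qed.

(** By monotonicity of [r], every counted position is available for k. The position of k is
    available too but is not counted. *)
Lemma smaller_after_lt (r : 'I_n -> nat) s k :
  (forall i j, i <= j -> r i <= r j) -> s \in signed_perms_below r ->
  smaller_after s k < heights r k.
Proof.
move=> r_mono sr; have [sB sbelow] := signed_perms_belowP _ _ sr.
rewrite -(card_available k sr) /smaller_after; set p := (_ (posl k)).1.
have vp : (s (posl p)).1 = k by rewrite signed_inv_posl.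
have kp : k < r p by have := sbelow (posl p); rewrite vp.
apply/proper_card/properP; split.
  apply/subsetP => j; rewrite !inE => /andP[pj jk].
  by rewrite (ltnW jk) (leq_trans kp) // r_mono // ltnW.
by exists p; rewrite !inE ?kp ?vp ?leqnn ?ltnn.
Qed.

Lemma smaller_after_inj s u : s \in signed_perms n -> u \in signed_perms n ->
  (forall k, smaller_after s k = smaller_after u k) ->
  (forall k, ((s^-1)%g (posl k)).2 = ((u^-1)%g (posl k)).2) -> s = u.
Proof.
pose pos s k := ((s^-1)%g (posl k)).1.
have posE t k j : t \in signed_perms n -> (pos t k == j) = ((t (posl j)).1 == k).
  by move=> tB; rewrite -(signed_abs _ (posl j) tB) permKV eq_sym.
(* If all values above k have the same positions in both, then so do the places left for values at
   most k. *)
have free t w k : t \in signed_perms n -> w \in signed_perms n ->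
    (forall l : 'I_n, k < l -> pos t l = pos w l) ->
    forall j, (t (posl j)).1 <= k -> (w (posl j)).1 <= k.
  move=> tB wB h j; apply: contraTT; rewrite -!ltnNge => kl.
  suff -> : (t (posl j)).1 = (w (posl j)).1 by [].
  by apply/eqP; rewrite -posE // h // posE.
(* If k stands further left in [t], all that is counted for [w] is counted for [t], and so is the
   position of k in [w], where [t] has a smaller value. *)
have lt t w k : t \in signed_perms n -> w \in signed_perms n ->
    (forall l : 'I_n, k < l -> pos t l = pos w l) ->
    pos t k < pos w k -> smaller_after w k < smaller_after t k.
  move=> tB wB h ptw; have tw := free w t k wB tB (fun l kl => esym (h l kl)).
  have vt j : pos t k < j -> (t (posl j)).1 != k.
    by move=> pj; rewrite -posE //; apply: contraTneq pj => ->; rewrite ltnn.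
  have vw : (w (posl (pos w k))).1 = k by rewrite signed_inv_posl.
  apply/proper_card/properP; split.
    apply/subsetP => j; rewrite !inE => /andP[pj jk].
    have pj' := ltn_trans ptw pj; rewrite pj' ltn_neqAle (inj_eq val_inj) vt //.
    exact/tw/ltnW.
  exists (pos w k); rewrite !inE ?ltnn // ptw ltn_neqAle (inj_eq val_inj) vt //=.
  by rewrite tw ?vw.
move=> sB uB su_after su_sgn.
have pos_eq m : m <= n -> forall k : 'I_n, m <= k -> pos s k = pos u k.
  move: m; apply: ord_down_ind => [k|k IH l]; first by rewrite leqNgt ltn_ord.
  rewrite leq_eqVlt => /orP[/eqP/val_inj <-|/IH//].
  apply: val_inj; case: (ltngtP (pos s k) (pos u k)) => // h.
    by have := lt s u k sB uB IH h; rewrite su_after ltnn.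
  by have := lt u s k uB sB (fun l kl => esym (IH l kl)) h; rewrite su_after ltnn.
apply: invg_inj; apply/permP => -[k b].
have VB t : t \in signed_perms n -> (t^-1)%g \in signed_perms n.
  by rewrite -(groupV (signed_perms_group n)).
rewrite (signed_posl k b (VB s sB)) (signed_posl k b (VB u uB)) su_sgn.
by rewrite -/(pos s k) (pos_eq 0).
Qed.

End Inversions.

(** * Both generating functions as products over k *)

Section Weights.

Variables (n : nat) (r : 'I_n -> nat).
Implicit Types (s : {perm letter n}) (k : 'I_n) (y : 'I_n.+1 * bool).

Definition weight k (a : nat) (b : bool) : {poly {poly int}} :=
  (qvar ^+ (if b then 2 * k.+1 - 1 - a else a)%N * tvar ^+ (b || (a != 0%N)))%R.

(** The ambient type is the same for all k, so that families of codes are finite functions; it is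
    inhabited even for n = 0, as [inord] requires. *)
Definition codes k : {set 'I_n.+1 * bool} :=
  [set y : 'I_n.+1 * bool | y.1 < heights r k].

Lemma heights_leq k : heights r k <= n.+1.
Proof. by rewrite (leq_trans (leq_subr _ _)) // leqW // ltn_ord. Qed.

Lemma card_codes k : #|codes k| = heights r k * 2.
Proof.
rewrite -[X in X * _](_ : #|[set i : 'I_n.+1 | i < heights r k]| = _).
  rewrite -card_bool -cardsT -cardsX; apply: eq_card => y.
  by rewrite !inE andbT.
rewrite -sum1dep_card -(big_ord_widen n.+1 (fun _ => 1)) ?heights_leq //.
by rewrite sum_nat_const card_ord muln1.
Qed.

Lemma inord_heights k a : a < heights r k -> (inord a : 'I_n.+1) = a :> nat.
Proof. by move=> ak; rewrite inordK // (leq_trans ak) ?heights_leq. Qed.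

Lemma prod_codes (R : comPzSemiRingType) (F : 'I_n -> 'I_n.+1 * bool -> R) :
  (\prod_(k < n) \sum_(y in codes k) F k y =
  \sum_(f in [set f : {ffun 'I_n -> 'I_n.+1 * bool} |
                [forall k, f k \in codes k]])
    \prod_(k < n) F k (f k))%R.
Proof.
rewrite bigA_distr_big_dep; apply: eq_bigl => f.
by rewrite inE; apply/familyP/forallP.
Qed.

Hypothesis r_mono : forall i j : 'I_n, i <= j -> r i <= r j.
Hypothesis r_len : forall k : 'I_n, r k <= n.
Hypothesis r_gek : forall k : 'I_n, k < r k.

(** Both statistics are sums over the slots, so the sum factors; each factor is then reindexed by
    the code and sign of the slot, an injection between sets of equal size. *)
Lemma sum_sor (s0 : {perm letter n}) : s0 \in signed_perms_below r ->
  (forall i, (base s0 i).2 = false) ->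
  (\sum_(s in signed_perms_below r)
    qvar ^+ sor_r r s s0 * tvar ^+ reflection_length (s0^-1 * s)%g =
  \prod_(k < n) \sum_(y in codes k) weight k y.1 y.2)%R.
Proof.
move=> s0r s0_pos; have [s0B _] := signed_perms_belowP _ _ s0r.
transitivity (\prod_(k < n) \sum_(x in slots r s0 k)
    weight k (slot_code r s0 k x) x.2)%R.
  rewrite -(sum_slots s0r (fun k x => weight k (slot_code r s0 k x) x.2)).
  apply: eq_bigr => s sr; rewrite (reflection_length_slots s0r sr).
  rewrite /sor_r /sor -!GRing.prodrXr -big_split.
  apply: eq_bigr => k _ /=; congr (_ ^+ _ * _ ^+ _)%R; first exact: sor_at_slot.
  have xk : slot s0 s k \in slots r s0 k.
    exact/stage_slot/(sorted_above_stage s0r (ltn_ord k) sr).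
  (* As the base is positive, the slot is the base exactly when its code is 0 and its sign is
     positive. *)
  rewrite slot_code_eq0 //; case: (slot s0 s k) => i b.
  rewrite [base s0 k]surjective_pairing s0_pos xpair_eqE.
  by case: b; rewrite ?andbF ?andbT.
apply: eq_bigr => k _.
rewrite -(@sum_bij_card _ _ _ (slots r s0 k) (codes k)
  (fun x => (inord (slot_code r s0 k x), x.2)) (fun y => weight k y.1 y.2)).
- apply: eq_bigr => x _ /=.
  by rewrite (inord_heights (slot_code_lt r_mono r_len r_gek k x s0r)).
- move=> x y xk yk /= [/(congr1 (@nat_of_ord _))].
  rewrite !(@inord_heights k) ?slot_code_lt // => /slot_code_inj xy e2.
  by rewrite [x]surjective_pairing [y]surjective_pairing xy // e2.
- by move=> x _; rewrite inE /= (@inord_heights k) ?slot_code_lt.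
by rewrite card_codes (card_slots k s0r).
Qed.

(** Both statistics are read off the families of pairs (smaller values after k, sign of k). These
    determine [s], and a count shows that all admissible families occur. Nonemptiness supplies a
    reference permutation for that count. *)
Lemma sum_inv : signed_perms_below r != set0 ->
  (\sum_(s in signed_perms_below r) qvar ^+ invB s * tvar ^+ nminB s =
  \prod_(k < n) \sum_(y in codes k) weight k y.1 y.2)%R.
Proof.
case/set0Pn => s0 s0r; rewrite (prod_codes (fun k y => weight k y.1 y.2)).
set F := [set f | _].
pose code s : {ffun 'I_n -> 'I_n.+1 * bool} :=
  [ffun k => (inord (smaller_after s k), ((s^-1)%g (posl k)).2)].
have codeE s k : s \in signed_perms_below r ->
    (code s k).1 = smaller_after s k :> nat.
  by move=> sr; rewrite ffunE (@inord_heights k) ?smaller_after_lt.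
rewrite -(@sum_bij_card _ _ _ (signed_perms_below r) F code).
- apply: eq_bigr => s sr; have [sB _] := signed_perms_belowP _ _ sr.
  rewrite invB_slots // nminB_slots // -!GRing.prodrXr -big_split.
  by apply: eq_bigr => k _ /=; rewrite /weight codeE // ffunE.
- move=> s u sr ur e; have [sB _] := signed_perms_belowP _ _ sr.
  have [uB _] := signed_perms_belowP _ _ ur.
  apply: smaller_after_inj => // k; first by rewrite -!codeE // e.
  by have /ffunP/(_ k) := e; rewrite !ffunE => -[].
- move=> s sr; rewrite inE; apply/forallP => k.
  by rewrite inE codeE // smaller_after_lt.
(* Both cardinalities are products of the numbers 2 h_k; [prod_codes] with all weights 1 counts the
   families. *)
rewrite (card_signed_perms_below s0r) -sum1_card.
have := prod_codes (fun _ _ => 1); rewrite -/F => eF.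
rewrite (eq_bigr (fun f : {ffun 'I_n -> 'I_n.+1 * bool} => \prod_(k < n) 1));
  last by move=> f _; rewrite big1.
rewrite -[X in X <= _]eF; apply: leq_prod => k _.
by rewrite sum1_card card_codes (card_slots k s0r).
Qed.

End Weights.

Local Open Scope ring_scope.

(* Permutations in MathComp compose from left to right:
   (s0^-1 * s)%g x = s (s0^-1 x). *)
Theorem corollary3p11 (n : nat) (r : 'I_n -> nat)
    (r_ge1 : forall k : 'I_n, (1 <= r k)%N)
    (r_mono : forall i j : 'I_n, (i <= j)%N -> (r i <= r j)%N)
    (r_len : forall k : 'I_n, (r k <= n)%N)
    (r_gek : forall k : 'I_n, (k.+1 <= r k)%N)
    (s0 : {perm letter n}) (s0_in : s0 \in signed_perms_below r)
    (s0_pos : forall k : 'I_n, 0 < sint s0 k) :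
  \sum_(s in signed_perms_below r) qvar ^+ invB s * tvar ^+ nminB s =
  \sum_(s in signed_perms_below r)
    qvar ^+ sor_r r s s0 * tvar ^+ reflection_length (s0^-1 * s)%g.
Proof.
rewrite sum_sor // => [|i].
  by apply: sum_inv => //; apply/set0Pn; exists s0.
have [s0B _] := signed_perms_belowP _ _ s0_in.
(* The position of a value has the sign of the entry there, so positive entries of [s0] give
   positive bases. *)
have <- : (s0 (posl (base s0 i).1)).2 = (base s0 i).2 by rewrite signed_inv_posl.
by rewrite -sint_lt0 Order.POrderTheory.lt_gtF.
Qed.
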